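(* Let $X$ be a compact metric space, $Y$ a finite set (discrete metric space), $S$ a real Banach space, $\mathcal{F}\subset S^*$ a linear subspace separating the points of $S$, $\mu=(\frac{d\mu}{d|\mu|},|\mu|)\in\mathcal{M}(X,S)$ and $\nu\in\mathcal{M}(Y,S)$. Assume: (i) $\frac{d\mu}{d|\mu|}:X\to S$ is norm bounded and $w(\mathcal{F})$-continuous, and there exists $f\in C(X,\mathcal{F})$ with $\langle f(x),\frac{d\mu}{d|\mu|}(x)\rangle=1$ for all $x\in X$; (ii) for any measurable $A\subset X$ there exist a measurable $B\subset A$ and $\alpha\in(0,1)$ such that $\mu(B)=\alpha\mu(A)$; (iii) $\Pi(\mu,\nu,\frac{d\mu}{d|\mu|})\ne\emptyset$. Then $\mathcal{T}(\mu,\nu)\neq\emptyset$. Moreover, for every lower semicontinuous $c:X\times Y\to\mathbb{R}$ there exists an optimal transport map, meaning $$\min_{T\in\mathcal{T}(\mu,\nu)}\int_X c(x,Tx)\,d|\mu|(x)=\min_{\pi\in\Pi(\mu,\nu,\frac{d\mu}{d|\mu|})}\int_{X\times Y}c\,d\pi,$$ with both minima attained.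
   Context: Metric spaces carry their Borel $\sigma$-algebras. $\mathcal{M}_+(\Omega)$ is the set of finite non-negative (Borel) measures on $\Omega$. $\mathcal{M}(\Omega,S)$ is the set of $S$-valued measures $\mu$ of the form $\mu(A)=\int_A\eta\,d|\mu|$ (Bochner integral) for some $|\mu|\in\mathcal{M}_+(\Omega)$ and some Bochner integrable $\eta:\Omega\to S$; one writes $\mu=(\eta,|\mu|)$ and $\eta=\frac{d\mu}{d|\mu|}$ (such a representation is fixed). For $f:\Omega\to S^*$, $\int_\Omega f\,d\mu:=\int_\Omega\langle f,\frac{d\mu}{d|\mu|}\rangle\,d|\mu|$. $w(\mathcal{F})$ is the weak topology on $S$ generated by $\mathcal{F}$. $C(X,\mathcal{F})$ is the space of continuous functions into $\mathcal{F}$ with the norm of $S^*$. $\Pi(\mu,\nu,\frac{d\mu}{d|\mu|})$ is the set of $\pi\in\mathcal{M}_+(X\times Y)$ such that for all $\psi\in C(X,\mathcal{F})$, $\varphi\in C(Y,\mathcal{F})$: $\int_{X\times Y}\langle\psi(x)+\varphi(y),\frac{d\mu}{d|\mu|}(x)\rangle\,d\pi(x,y)=\int_X\psi\,d\mu+\int_Y\varphi\,d\nu$. $\mathcal{T}(\mu,\nu)$ is the set of transport maps: measurable $T:X\to Y$ with $T_\#\mu=\nu$, i.e. $\mu(T^{-1}(B))=\nu(B)$ for all measurable $B\subset Y$. A transport map $T$ is identified with the transport plan $(\mathrm{Id}_X\times T)_\#|\mu|\in\Pi(\mu,\nu,\frac{d\mu}{d|\mu|})$, whose cost is $\int_X c(x,Tx)\,d|\mu|(x)$.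 *)

(* Defs.v *)
From HB Require Import structures.
From mathcomp Require Import all_boot all_order all_algebra.
From mathcomp Require Import all_classical all_reals all_analysis.

Set Implicit Arguments.
Unset Strict Implicit.
Unset Printing Implicit Defensive.

Import Order.TTheory GRing.Theory Num.Theory.
Import numFieldNormedType.Exports.

Local Open Scope classical_set_scope.
Local Open Scope ring_scope.

(* The measurable types of the library are pointed, hence so are the metric
   spaces carrying measures here. *)
#[short(type="pmetricType")]
HB.structure Definition PointedMetric (K : numDomainType) :=
  {M of Pointed M & Metric K M}.

(* The Borel sigma-algebra is a structure on an alias of the carrier, so that
   on a product it is the one of the product topology and not the product
   sigma-algebra. *)
Notation borel T := (g_sigma_algebraType (@open T)).

(* The topological dual; the pairing <f, s> is the application f s. *)
Record dual (R : realType) (S : normedModType R) := Dual {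
  dual_fun :> S -> R^o ;
  dual_linear : linear dual_fun ;
  dual_continuous : continuous dual_fun }.

Section dual_normed.
Context {R : realType} {S : normedModType R}.
Implicit Types (f g : dual S) (k : R).

HB.instance Definition _ f :=
  GRing.isLinear.Build R S R^o *:%R (dual_fun f) (@dual_linear R S f).

HB.instance Definition _ := gen_eqMixin (dual S).
HB.instance Definition _ := gen_choiceMixin (dual S).

Lemma dualP f g : (forall s, f s = g s) -> f = g.
Proof.
case: f g => [f lf cf] [g lg cg] /= /funext fg; subst g.
by congr Dual; exact: Prop_irrelevance.
Qed.

Fact dual_zero_linear : linear ((fun=> 0) : S -> R^o).
Proof. by move=> k s t; rewrite scaler0 addr0. Qed.

Fact dual_zero_continuous : continuous ((fun=> 0) : S -> R^o).
Proof. by move=> s; exact: cvg_cst. Qed.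

Definition dual_zero := Dual dual_zero_linear dual_zero_continuous.

Fact dual_opp_linear f : linear (fun s : S => - f s : R^o).
Proof. by move=> k s t; rewrite linearP opprD scalerN. Qed.

Fact dual_opp_continuous f : continuous (fun s : S => - f s : R^o).
Proof. by move=> s; apply: cvgN; exact: dual_continuous. Qed.

Definition dual_opp f := Dual (@dual_opp_linear f) (@dual_opp_continuous f).

Fact dual_add_linear f g : linear (fun s : S => f s + g s : R^o).
Proof. by move=> k s t; rewrite !linearP scalerDr addrACA. Qed.

Fact dual_add_continuous f g : continuous (fun s : S => f s + g s : R^o).
Proof. by move=> s; apply: cvgD; exact: dual_continuous. Qed.

Definition dual_add f g :=
  Dual (@dual_add_linear f g) (@dual_add_continuous f g).

Fact dual_addA : associative dual_add.
Proof. by move=> f g h; apply: dualP => s /=; rewrite addrA. Qed.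

Fact dual_addC : commutative dual_add.
Proof. by move=> f g; apply: dualP => s /=; rewrite addrC. Qed.

Fact dual_add0 : left_id dual_zero dual_add.
Proof. by move=> f; apply: dualP => s /=; rewrite add0r. Qed.

Fact dual_addN : left_inverse dual_zero dual_opp dual_add.
Proof. by move=> f; apply: dualP => s /=; rewrite addNr. Qed.

HB.instance Definition _ :=
  GRing.isZmodule.Build (dual S) dual_addA dual_addC dual_add0 dual_addN.

Fact dual_scale_linear k f : linear (fun s : S => k * f s : R^o).
Proof.
by move=> l s t; rewrite linearP mulrDr; congr (_ + _); exact: mulrCA.
Qed.

Fact dual_scale_continuous k f : continuous (fun s : S => k * f s : R^o).
Proof. by move=> s; apply: cvgMr; exact: dual_continuous. Qed.

Definition dual_scale k f :=
  Dual (@dual_scale_linear k f) (@dual_scale_continuous k f).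

Fact dual_scaleA k l f :
  dual_scale k (dual_scale l f) = dual_scale (k * l) f.
Proof. by apply: dualP => s /=; rewrite mulrA. Qed.

Fact dual_scale1 : left_id 1 dual_scale.
Proof. by move=> f; apply: dualP => s /=; rewrite mul1r. Qed.

Fact dual_scaleDr : right_distributive dual_scale +%R.
Proof. by move=> k f g; apply: dualP => s /=; rewrite mulrDr. Qed.

Fact dual_scaleDl f : {morph dual_scale^~ f : k l / k + l}.
Proof. by move=> k l; apply: dualP => s /=; rewrite mulrDl. Qed.

HB.instance Definition _ := GRing.Zmodule_isLmodule.Build R (dual S)
  dual_scaleA dual_scale1 dual_scaleDr dual_scaleDl.

(* The operator norm, as a supremum over the closed unit ball. *)
Definition dual_norm f : R := sup [set `|f s| | s in [set s : S | `|s| <= 1]].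

Fact dual_norm_has_sup f : has_sup [set `|f s| | s in [set s : S | `|s| <= 1]].
Proof.
split; first by exists `|f 0|; exists 0 => //=; rewrite normr0.
have : bounded_near f (nbhs 0).
  by apply: continuous_linear_bounded; exact: dual_continuous.
move/linear_boundedP/pinfty_ex_gt0 => [r r0 fr].
exists r => _ [s /= s1 <-]; apply: le_trans (fr s) _.
by rewrite ler_piMr// ltW.
Qed.

Fact dual_norm_ub f s : `|s| <= 1 -> `|f s| <= dual_norm f.
Proof.
by move=> s1; apply: ub_le_sup; [exact: (dual_norm_has_sup f).2|exists s].
Qed.

Fact dual_norm_le f (r : R) :
  (forall s, `|s| <= 1 -> `|f s| <= r) -> dual_norm f <= r.
Proof.
move=> fr; apply: ge_sup; first exact: (dual_norm_has_sup f).1.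
by move=> _ [s s1 <-]; exact: fr.
Qed.

Lemma dual_norm_ge0 f : 0 <= dual_norm f.
Proof. by rewrite (le_trans (normr_ge0 (f 0)))// dual_norm_ub// normr0. Qed.

Lemma dual_pairing_le f s : `|f s| <= dual_norm f * `|s|.
Proof.
have [->|s0] := eqVneq s 0; first by rewrite linear0 !normr0 mulr0.
have ns : 0 < `|s| by rewrite normr_gt0.
rewrite -ler_pdivrMr// mulrC -[X in X * _ <= _]gtr0_norm ?invr_gt0//.
rewrite -normrM -[_ * _]/(_ *: (f s : R^o)) -linearZ dual_norm_ub//.
by rewrite normrZ normfV normr_id mulVf// gt_eqF.
Qed.

Fact dual_normD f g : dual_norm (f + g) <= dual_norm f + dual_norm g.
Proof.
apply: dual_norm_le => s s1; apply: le_trans (ler_normD _ _) _.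
by rewrite lerD// dual_norm_ub.
Qed.

Fact dual_normZ k f : dual_norm (k *: f) = `|k| * dual_norm f.
Proof.
have normZ_le l g : dual_norm (l *: g) <= `|l| * dual_norm g.
  apply: dual_norm_le => s s1; rewrite [X in `|X| <= _]/(l * g s) normrM.
  by rewrite ler_wpM2l// dual_norm_ub.
apply/eqP; rewrite eq_le normZ_le /=.
have [->|k0] := eqVneq k 0; first by rewrite normr0 mul0r dual_norm_ge0.
have := normZ_le k^-1 (k *: f).
by rewrite scalerA mulVf// scale1r normfV ler_pdivlMl// normr_gt0.
Qed.

Fact dual_norm0_eq0 f : dual_norm f = 0 -> f = 0.
Proof.
move=> f0; apply: dualP => s; apply/eqP; rewrite -normr_le0.
by rewrite (le_trans (dual_pairing_le f s))// f0 mul0r.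
Qed.

HB.instance Definition _ := Lmodule_isNormed.Build R (dual S)
  dual_normD dual_normZ dual_norm0_eq0.

End dual_normed.

Definition linear_subspace {R : realType} {S : normedModType R}
  (F : set (dual S)) :=
  F 0 /\ forall (k : R) f g, F f -> F g -> F (k *: f + g).

Definition separates_points {R : realType} {S : normedModType R}
  (F : set (dual S)) :=
  forall s t : S, s <> t -> exists2 f, F f & f s <> f t.

(* The topology w(F), as a structure on an alias of S. *)
Definition weak_space {R : realType} {S : normedModType R}
  (F : set (dual S)) : Type :=
  sup_topology (fun f : {f : dual S | F f} =>
    Topological.class (initial_topology (sval f : S -> R^o))).

HB.instance Definition _ {R : realType} {S : normedModType R}
  (F : set (dual S)) := Topological.on (weak_space F).

Definition cont_into {R : realType} {S : normedModType R}
  (X : topologicalType) (F : set (dual S)) : set (X -> dual S) :=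
  [set f | continuous f /\ forall x, F (f x)].
Arguments cont_into {R S} X F.

Section bochner.
Local Open Scope ereal_scope.
Context d (T : measurableType d) (R : realType) (S : normedModType R).
Variable mu : {finite_measure set T -> \bar R}.
Implicit Types (A : set T) (f s : T -> S).

Definition simple_function s :=
  finite_set (range s) /\ forall v, measurable (s @^-1` [set v]).

Definition simple_integral A s : S :=
  (\sum_(v \in range s) fine (mu (A `&` s @^-1` [set v])) *: v)%R.

Definition strongly_measurable f :=
  exists s : nat -> T -> S, (forall n, simple_function (s n)) /\
    {ae mu, forall x, s ^~ x @ \oo --> f x}.

Definition bochner_integrable f :=
  strongly_measurable f /\
  exists s : nat -> T -> S, (forall n, simple_function (s n)) /\
    \int[mu]_x `|f x - s n x|%:E @[n --> \oo] --> 0.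

Definition is_bochner_integral A f (v : S) :=
  exists s : nat -> T -> S, [/\ forall n, simple_function (s n),
    \int[mu]_(x in A) `|f x - s n x|%:E @[n --> \oo] --> 0 &
    simple_integral A (s n) @[n --> \oo] --> v].

(* Meaningful for A measurable, f Bochner integrable and S complete: the value
   then exists and is unique. *)
Definition bochner_integral A f : S := get (is_bochner_integral A f).

End bochner.

(* An element (eta, |mu|) of M(Omega, S); the representation is part of the
   data, and "variation" is |mu|, not necessarily the total variation. *)
Record vmeasure (R : realType) (Omega : ptopologicalType)
    (S : completeNormedModType R) := VMeasure {
  variation : {finite_measure set (borel Omega) -> \bar R} ;
  density : Omega -> S ;
  density_integrable : bochner_integrable variation density }.

Section transport.
Context {R : realType} {S : completeNormedModType R}.

Definition vmeasure_val {Omega : ptopologicalType} (mu : vmeasure Omega S)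
  (A : set Omega) : S := bochner_integral (variation mu) A (density mu).

Definition pairing_integral {Omega : ptopologicalType} (f : Omega -> dual S)
    (mu : vmeasure Omega S) : \bar R :=
  (\int[variation mu]_x (f x (density mu x))%:E)%E.

Context {X Y : ptopologicalType}.
Variables (F : set (dual S)) (mu : vmeasure X S) (nu : vmeasure Y S).

Definition transport_plans :
    set {finite_measure set (borel (X * Y)%type) -> \bar R} :=
  [set pi : {finite_measure set (borel (X * Y)%type) -> \bar R} |
   forall psi phi, cont_into X F psi -> cont_into Y F phi ->
    (\int[pi]_z
       ((psi (z : X * Y).1 + phi (z : X * Y).2)
          (density mu (z : X * Y).1))%:E
     = pairing_integral psi mu + pairing_integral phi nu)%E].

Definition transport_maps : set (X -> Y) :=
  [set T | measurable_fun setT (T : borel X -> borel Y) /\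
    forall B : set (borel Y), measurable B ->
      vmeasure_val mu (T @^-1` B) = vmeasure_val nu B].

Variable c : X * Y -> R.

Definition plan_cost (pi : {finite_measure set (borel (X * Y)%type) -> \bar R}) :
  \bar R := (\int[pi]_z (c z)%:E)%E.

Definition map_cost (T : X -> Y) : \bar R :=
  (\int[variation mu]_x (c (x, T x))%:E)%E.

End transport.

Definition is_minimum {R : realType} (A : set (\bar R)) (m : \bar R) :=
  A m /\ lbound A m.

(* Main.v *)
Require Import Defs.
From HB Require Import structures.
From mathcomp Require Import all_boot all_order all_algebra.
From mathcomp Require Import finmap lra.
From mathcomp Require Import all_classical all_reals all_analysis.
From mathcomp Require Import measurable_realfun.

Set Implicit Arguments.
Unset Strict Implicit.
Unset Printing Implicit Defensive.

Import Order.TTheory GRing.Theory Num.Theory.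
Import numFieldNormedType.Exports.

Local Open Scope classical_set_scope.
Local Open Scope ring_scope.

(* A plan for a finite target is a decomposition of |mu| into measures pi_y with
   int <l, dmu/d|mu|> dpi_y = <l, nu {y}> for every l in F: testing with multiples
   of the normalized f shows that the first marginal of a plan is |mu|.  Viewed as
   positive functionals on bounded measurable functions, these decompositions
   form a closed convex subset of a product of segments, compact by Tychonoff's
   theorem, and the cost is a supremum of continuous affine functionals; hence
   some extreme point minimizes it.  At an extreme point the densities g_y of the
   pi_y take values in {0, 1}: if g_y and g_y' were both at least eps on a
   non-null set A, then for B included in A with mu B = alpha mu A one could
   perturb them by +/- eps (1_B - alpha 1_A) and keep all constraints.  The
   minimizer is therefore induced by a map. *)

(** * Extreme minimizers in products of lines *)

(** Decompositions are topologized by pointwise convergence on all bounded measurable functions, not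
    by narrow convergence. Each constraint then involves finitely many coordinates and is trivially
    closed; the price is that a limit functional is a priori only finitely additive. The mass
    constraint repairs this: each component is dominated by |mu|, which restores countable
    additivity and yields Radon-Nikodym densities with values in [0, 1]. A lower semicontinuous cost
    may be unbounded above, so it is not itself a coordinate; once shifted to be nonnegative it is
    the increasing limit of its truncations at height n, which are. The functional cost may thus be
    +oo, and minimality and extremality are combined through faces, which tolerate this value.
    Assumption (ii) is an equality of vectors: paired with the elements of F, it says that 1_B -
    alpha 1_A is orthogonal to all the constraints, and conversely F separates points, so that the
    scalar constraints recover the vector equality required of a map. *)

Lemma continuous_sum (R : realType) (T : topologicalType) (I : Type)
    (s : seq I) (f : I -> T -> R) : (forall i, continuous (f i)) ->
  continuous (fun x => \sum_(i <- s) f i x).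
Proof.
move=> cf; elim: s => [|i s IH].
  by under eq_fun do rewrite big_nil; exact: cst_continuous.
under eq_fun do rewrite big_cons.
by move=> x; apply: cvgD; [exact: cf|exact: IH].
Qed.

Lemma continuous_linear3 (R : realType) (T : topologicalType) (r : R)
    (f g h : T -> R) : continuous f -> continuous g -> continuous h ->
  continuous (fun x => f x - (r * g x + h x)).
Proof.
move=> cf cg ch x; apply: cvgB; first exact: cf.
by apply: cvgD; [apply: cvgMl_tmp; exact: cg|exact: ch].
Qed.

Section product_closed_sets.
Context {R : realType} {J : choiceType}.
Local Notation V := (prod_topology (fun _ : J => R)).

Lemma proj_continuous_fun (j : J) : continuous (fun P : V => P j).
Proof. exact: (@proj_continuous J (fun=> R) j). Qed.

Lemma sum_proj_continuous (I : Type) (s : seq I) (j : I -> J) :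
  continuous (fun P : V => \sum_(i <- s) P (j i)).
Proof. by apply: continuous_sum => i; exact: proj_continuous_fun. Qed.

Lemma closed_proj_eq (j : J) (r : R) : closed [set P : V | P j = r].
Proof.
apply: (@closed_comp _ _ (fun P : V => P j) [set x | x = r]).
  by move=> P _; exact: proj_continuous_fun.
exact: closed_eq.
Qed.

Lemma closed_proj_ge (j : J) (r : R) : closed [set P : V | r <= P j].
Proof.
apply: (@closed_comp _ _ (fun P : V => P j) [set x | r <= x]).
  by move=> P _; exact: proj_continuous_fun.
exact: closed_ge.
Qed.

Lemma closed_proj_linear (i j k : J) (r : R) :
  closed [set P : V | P i = r * P j + P k].
Proof.
rewrite (_ : [set _ | _] = [set P : V | P i - (r * P j + P k) = 0]); last first.
  apply/seteqP; split=> P /= => [->|/eqP]; first by rewrite subrr.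
  by rewrite subr_eq0 => /eqP.
apply: (@closed_comp _ _ (fun P : V => P i - (r * P j + P k)) [set x | x = 0]).
  by move=> P _; apply: continuous_linear3; exact: proj_continuous_fun.
exact: closed_eq.
Qed.

Lemma closed_sum_proj_eq (I : Type) (s : seq I) (j : I -> J) (r : R) :
  closed [set P : V | \sum_(i <- s) P (j i) = r].
Proof.
apply: (@closed_comp _ _ (fun P : V => \sum_(i <- s) P (j i)) [set x | x = r]).
  by move=> P _; exact: sum_proj_continuous.
exact: closed_eq.
Qed.

Lemma closed_EFin_le (r : \bar R) : closed [set x : R | (x%:E <= r)%E].
Proof.
case: r => [r| |].
- by under eq_set do rewrite lee_fin; exact: closed_le.
- rewrite (_ : [set _ | _] = setT); first exact: closedT.
  by apply/seteqP; split=> //x _ /=; rewrite leey.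
- rewrite (_ : [set _ | _] = set0); first exact: closed0.
  by apply/seteqP; split=> // x.
Qed.

Lemma closed_proj_le (j : J) (r : \bar R) :
  closed [set P : V | ((P j)%:E <= r)%E].
Proof.
apply: (@closed_comp _ _ (fun P : V => P j) [set x | (x%:E <= r)%E]).
  by move=> P _; exact: proj_continuous_fun.
exact: closed_EFin_le.
Qed.

Lemma closed_sum_proj_le (I : Type) (s : seq I) (j : I -> J) (r : \bar R) :
  closed [set P : V | ((\sum_(i <- s) P (j i))%:E <= r)%E].
Proof.
apply: (@closed_comp _ _ (fun P : V => \sum_(i <- s) P (j i))
  [set x | (x%:E <= r)%E]).
  by move=> P _; exact: sum_proj_continuous.
exact: closed_EFin_le.
Qed.

End product_closed_sets.

(** The sets of points of [K] where [J] is at most [J q], for [q] in [K], have the finite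
    intersection property: among finitely many [q], one with the least value lies in all of them. A
    point common to all these sets is a minimizer. *)
Lemma compact_lsc_min (R : realType) (T : ptopologicalType) (K : set T)
    (J : T -> \bar R) : compact K -> K !=set0 ->
    (forall r, closed [set x | (J x <= r)%E]) ->
  exists2 p, K p & forall q, K q -> (J p <= J q)%E.
Proof.
rewrite compact_In0 => cK [k0 Kk0] clJ.
have [|D DK|p Jp] := cK _ K (fun q => K `&` [set x | (J x <= J q)%E]).
- by exists (fun q => [set x | (J x <= J q)%E]).
- have {}DK q : q \in enum_fset D -> K q by move=> /DK/set_mem.
  suff [p Kp pD] : exists2 p, K p &
      forall q, q \in enum_fset D -> (J p <= J q)%E.
    by exists p => q /= qD; split => //; exact: pD.
  elim: (enum_fset D) DK => [_|q s IH sK]; first by exists k0.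
  have [|p Kp ps] := IH; first by move=> r rs; apply: sK; rewrite inE rs orbT.
  have Kq : K q by apply: sK; rewrite inE eqxx.
  have [pq|/ltW qp] := leP (J p) (J q).
    by exists p => // r; rewrite inE => /predU1P[->//|]; exact: ps.
  exists q => // r; rewrite inE => /predU1P[->//|/ps]; exact: le_trans.
- by exists p; [have [] := Jp _ Kk0|move=> q /Jp[]].
Qed.

HB.instance Definition _ (I : Type) (T : I -> ptopologicalType) :=
  isPointed.Build (prod_topology T) (fun=> point).

Section extreme_points.
Context {R : realType} {I : choiceType}.
Local Notation V := (prod_topology (fun _ : I => R)).
Implicit Types (K A : set V) (M N P : V) (J : V -> \bar R).

(** Stated coordinatewise and without division, so that [V] needs no vector space structure. *)
Definition midpoint M N P := forall i, M i + N i = P i + P i.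

(** The faces of convex geometry, tested on midpoints only. The conclusion names one endpoint; the
    other follows by exchanging the two. *)
Definition face K A := A `<=` K /\
  forall M N P, K M -> K N -> A P -> midpoint M N P -> A M.

Definition argmin A J := A `&` [set M | forall N, A N -> (J M <= J N)%E].

Lemma face_trans K A B : face K A -> face A B -> face K B.
Proof.
move=> [AK fA] [BA fB]; split=> [|M N P KM KN BP MNP].
  exact: subset_trans BA AK.
have AP := BA _ BP; apply: (fB M N P) => //; first exact: fA MNP.
by apply: (fA N M P) => // i; rewrite addrC.
Qed.

(** If [J P] is finite and minimal, two values at least [J P] with sum [J P + J P] both equal it; if
    it is [+oo], every point of [A] is a minimizer. Excluding [-oo] keeps the sums meaningful. *)
Lemma argmin_face A J : (forall M, A M -> (-oo < J M)%E) ->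
  (forall M N P, A M -> A N -> A P -> midpoint M N P ->
    (J M + J N = J P + J P)%E) ->
  face A (argmin A J).
Proof.
move=> Joo Jmid; split=> [|M N P AM AN [AP Pmin] MNP]; first by move=> ? [].
split=> //= Q AQ; apply: le_trans (Pmin _ AQ).
have PM := Pmin _ AM; have PN := Pmin _ AN.
move: (Jmid _ _ _ AM AN AP MNP) (Joo _ AM) (Joo _ AN) (Joo _ AP) PM PN.
case: (J P) (J M) (J N) => [p| |] [m| |] [n| |]//=.
rewrite -!EFinD !lee_fin => -[mnp] _ _ _ pm pn.
rewrite -(lerD2r p) -mnp lerD2l//.
Qed.

Lemma argmin_closed A J : closed A -> A !=set0 -> compact A ->
    (forall r, closed [set x | (J x <= r)%E]) ->
  closed (argmin A J) /\ argmin A J !=set0.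
Proof.
move=> cA A0 coA cJ; have [p Ap pmin] := compact_lsc_min coA A0 cJ.
split; last by exists p.
suff -> : argmin A J = A `&` [set x | (J x <= J p)%E] by exact: closedI.
apply/seteqP; split=> M [AM /= Mmin]; split=> //=; first exact: Mmin.
by move=> N /pmin; exact: le_trans.
Qed.

(* A minimal closed face is a singleton, since every coordinate functional is
   constant on it; so a minimal closed face inside the face of minimizers of
   [J] is an extreme minimizer. *)
Lemma extreme_minimizer K J : closed K -> compact K -> K !=set0 ->
    (forall r, closed [set x | (J x <= r)%E]) ->
    (forall M, K M -> (-oo < J M)%E) ->
    (forall M N P, K M -> K N -> K P -> midpoint M N P ->
      (J M + J N = J P + J P)%E) ->
  exists P, [/\ K P, forall N, K N -> (J P <= J N)%E &
    forall M N, K M -> K N -> midpoint M N P -> M = P].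
Proof.
move=> clK coK K0 clJ Joo Jmid.
have [clA A0] := argmin_closed clK K0 coK clJ.
have fA := argmin_face Joo Jmid.
set A := argmin K J in clA A0 fA.
have coA : compact A by apply: subclosed_compact clA coK _; exact: fA.1.
(* [Zorn_bigcup] yields a maximal set, whereas a minimal face is wanted; closed faces are therefore
   represented as [A] minus the set to be maximized. *)
pose good B := [/\ closed (A `\` B), A `\` B !=set0 & face K (A `\` B)].
have [|B [[clB B0 fB] Bmax]] := @Zorn_bigcup V good.
  move=> F Fgood Ftot.
  have bigD : A `\` \bigcup_(B in F) B = A `&` \bigcap_(B in F) (A `\` B).
    apply/seteqP; split=> [M [AM nM]|M [AM nM]]; split=> //.
      by move=> B FB; split=> // BM; apply: nM; exists B.
    by move=> [B FB BM]; have [] := nM B FB.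
  rewrite /good bigD; split.
  - by apply: closedI => //; apply: closed_bigI => B /Fgood[].
  - have [->|/set0P[B0 FB0]] := eqVneq F set0; first by rewrite bigcap_set0 setIT.
    (* The faces of a chain have a common point: finitely many of them contain the smallest one,
       which is not empty. *)
    move: coA; rewrite compact_In0 => /(_ _ F (fun B => A `\` B))[|D DF|M FM].
    + exists (fun B => A `\` B); first by move=> B /Fgood[].
      by move=> B _; apply/seteqP; split=> [M []|M [? []]].
    + have {}DF B : B \in enum_fset D -> F B by move=> /DF/set_mem.
      suff [B FB BD] : exists2 B, F B & forall C, C \in enum_fset D -> C `<=` B.
        have [_ [M [AM nBM]] _] := Fgood _ FB.
        by exists M => C /= CD; split=> //; apply: contra_not nBM; exact: BD.
      elim: (enum_fset D) DF => [_|q s IH sK]; first by exists B0.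
      have [|p Kp ps] := IH; first by move=> r rs; apply: sK; rewrite inE rs orbT.
      have Kq : F q by apply: sK; rewrite inE eqxx.
      have [qp|pq] := Ftot _ _ Kq Kp.
        by exists p => // r; rewrite inE => /predU1P[->//|]; exact: ps.
      exists q => // r; rewrite inE => /predU1P[->//|/ps rp].
      exact: subset_trans rp pq.
    + by exists M; split=> //; have [] := FM _ FB0.
  - split=> [M [/fA.1//]|M N P KM KN [AP nP] MNP]; split=> [|B FB].
      exact: fA.2 MNP.
    have [_ _ [_ fB]] := Fgood _ FB; exact: fB (nP _ FB) MNP.
set C := A `\` B in clB B0 fB.
have CK : C `<=` K by exact: fB.1.
have coC : compact C by apply: subclosed_compact clB coK _.
have const i M N : C M -> C N -> M i <= N i.
  move=> CM CN; pose Ji (M : V) := (M i)%:E.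
  have [clD D0] := argmin_closed clB B0 coC (@closed_proj_le R I i).
  have fD : face C (argmin C Ji).
    apply: argmin_face; first by move=> *; exact: ltNyr.
    by move=> M' N' P _ _ _ MNP; rewrite /Ji -!EFinD MNP.
  have [DM|nDM] := pselect (argmin C Ji M).
    by have := DM.2 _ CN; rewrite lee_fin.
  (* The face of [C] minimizing coordinate [i] would be strictly smaller than [C], since it misses
     [M]; its complement then strictly contains [B], against maximality. *)
  exfalso; apply: (Bmax (~` argmin C Ji)).
    rewrite properEneq; split; last first.
      by move=> Q BQ [[_ nBQ] _].
    by apply/eqP => BD; apply: CM.2; rewrite BD.
  have AD : A `\` ~` argmin C Ji = argmin C Ji.
    apply/seteqP; split=> [Q [_ /contrapT]//|Q DQ].
    by split; [case: DQ => -[]|exact].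
  by rewrite /good AD; split=> //; exact: face_trans fB fD.
have [P CP] := B0; exists P; split=> [|N KN|M N KM KN MNP].
- exact: CK.
- by case: CP => -[_ Pmin] _; exact: Pmin.
- have CM : C M by exact: fB.2 MNP.
  by apply/funext => i; apply/eqP; rewrite eq_le !const.
Qed.

End extreme_points.

(** * Densities of dominated set functions *)

Section bounded_measurable.
Context d (T : measurableType d) (R : realType).
Implicit Types (u v : T -> R) (m : {finite_measure set T -> \bar R}).

(** Bounded everywhere and without reference to a measure, so that the same test functions serve for
    [lam] and for all components of a decomposition. *)
Definition bounded_measurable u :=
  measurable_fun setT u /\ exists r, forall x, `|u x| <= r.

Lemma bounded_measurable_integrable m u A : measurable A ->
  bounded_measurable u -> m.-integrable A (EFin \o u).
Proof.
move=> mA [mu [r ur]]; apply: measurable_bounded_integrable => //.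
- by rewrite ltey_eq fin_num_measure.
- exact: measurable_funTS.
- by exists r; split; [exact: num_real|move=> s rs x _ /=; exact: le_trans (ltW rs)].
Qed.

Lemma bounded_measurableZD (k : R) u v : bounded_measurable u ->
  bounded_measurable v -> bounded_measurable (fun x => k * u x + v x).
Proof.
move=> [mu [r ur]] [mv [s vs]]; split.
  by apply: measurable_funD => //; exact: measurable_funM.
exists (`|k| * r + s) => x; apply: le_trans (ler_normD _ _) _.
by rewrite lerD// normrM ler_wpM2l.
Qed.

Lemma bounded_measurable_cst (k : R) : bounded_measurable (fun=> k).
Proof. by split; [exact: measurable_cst|exists `|k|]. Qed.

Lemma bounded_measurableZ (k : R) u : bounded_measurable u ->
  bounded_measurable (fun x => k * u x).
Proof.
move=> bu; have := bounded_measurableZD k bu (bounded_measurable_cst 0).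
by under eq_fun do rewrite addr0.
Qed.

Lemma bounded_measurableD u v : bounded_measurable u -> bounded_measurable v ->
  bounded_measurable (fun x => u x + v x).
Proof.
move=> bu bv; have := bounded_measurableZD 1 bu bv.
by under eq_fun do rewrite mul1r.
Qed.

Lemma bounded_measurableB u v : bounded_measurable u -> bounded_measurable v ->
  bounded_measurable (fun x => u x - v x).
Proof.
move=> bu bv; have := bounded_measurableZD (-1) bv bu.
by under eq_fun do rewrite mulN1r addrC.
Qed.

Lemma bounded_measurableM u v : bounded_measurable u -> bounded_measurable v ->
  bounded_measurable (fun x => u x * v x).
Proof.
move=> [mu [r ur]] [mv [s vs]]; split; first exact: measurable_funM.
by exists (r * s) => x; rewrite normrM ler_pM.
Qed.

Lemma bounded_measurable_norm u : bounded_measurable u ->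
  bounded_measurable (fun x => `|u x|).
Proof.
move=> [mu [r ur]]; split; first exact: measurableT_comp.
by exists r => x; rewrite normr_id.
Qed.

Lemma bounded_measurable_indic A : measurable A -> bounded_measurable \1_A.
Proof.
move=> mA; split; first exact: measurable_indic.
by exists 1 => x; rewrite indicE; case: (_ \in _); rewrite ?normr1 ?normr0.
Qed.

Lemma bounded_measurable_sum (I : Type) (s : seq I) (u : I -> T -> R) :
  (forall i, bounded_measurable (u i)) ->
  bounded_measurable (fun x => \sum_(i <- s) u i x).
Proof.
move=> bu; elim: s => [|i s IH].
  by under eq_fun do rewrite big_nil; exact: bounded_measurable_cst.
by under eq_fun do rewrite big_cons; exact: bounded_measurableD.
Qed.

Lemma Rintegral_setIr m u A B : measurable A ->
  \int[m]_(x in A) (\1_B x * u x) = \int[m]_(x in A `&` B) u x.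
Proof.
move=> mA; rewrite Rintegral_mkcondr; apply: eq_Rintegral => x _.
by rewrite patchE indicE; case: (x \in B); rewrite ?mul1r ?mul0r.
Qed.

Lemma Rintegral_indicM m u B :
  \int[m]_x (\1_B x * u x) = \int[m]_(x in B) u x.
Proof. by rewrite Rintegral_setIr// setTI. Qed.

Lemma Rintegral_indic m B : measurable B -> \int[m]_x (\1_B x : R) = fine (m B).
Proof. by move=> mB; rewrite /Rintegral integral_indic// setIT. Qed.

End bounded_measurable.

Section dominated_density.
Context d (T : measurableType d) (R : realType).
Variables (lam : {finite_measure set T -> \bar R}) (M : set T -> R).
Hypothesis M_ge0 : forall A, 0 <= M A.
Hypothesis M_le : forall A, measurable A -> M A <= fine (lam A).
Hypothesis M_additive : forall A B, measurable A -> measurable B ->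
  A `&` B = set0 -> M (A `|` B) = M A + M B.

Let nu (A : set T) : \bar R := (M A)%:E.

Let nu_set0 : nu set0 = 0%E.
Proof.
congr EFin; apply/eqP; rewrite eq_le M_ge0 andbT.
by rewrite (le_trans (M_le measurable0))// measure0.
Qed.

Let nu_ge0 A : (0 <= nu A)%E. Proof. by rewrite lee_fin. Qed.

(* Additivity and domination by [lam] give countable additivity: the tails
   are squeezed by those of [lam]. *)
Let nu_sigma_additive : semi_sigma_additive nu.
Proof.
move=> F mF tF mUF; set U := \bigcup_i F i.
pose G n := \bigcup_(i < n) F i; pose B n := U `\` G n.
have mG n : measurable (G n) by exact: bigcup_measurable.
have mB n : measurable (B n) by exact: measurableD.
have nuG n : (\sum_(0 <= i < n) nu (F i) = nu (G n))%E.
  elim: n => [|n IH]; first by rewrite big_geq// /G bigcup_mkord big_ord0 nu_set0.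
  rewrite big_nat_recr//= IH /nu -EFinD -M_additive//.
    by rewrite /G !bigcup_mkord big_ord_recr.
  apply/seteqP; split=> // x [[i /= ni Fix] Fnx].
  have /trivIsetP/(_ n i I I) := tF; rewrite gt_eqF// => /(_ isT) FnFi.
  by have : (F n `&` F i) x by []; rewrite FnFi.
have GB n : M U = M (G n) + M (B n).
  rewrite -M_additive//.
  - congr M; rewrite /B setUDr setDv setD0 setUidr// => x [i _ Fix].
    by exists i.
  - by apply/seteqP; split=> // x [Gx [_]].
have lamB : fine (lam (B n)) @[n --> \oo] --> (0 : R).
  have B0 : \bigcap_n B n = set0.
    apply/seteqP; split=> // x Bx; have [[n _ Fnx] _] := Bx 0 I.
    by have [_] := Bx n.+1 I; apply; exists n => /=.
  have : lam \o B @ \oo --> lam (\bigcap_n B n).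
    apply: nonincreasing_cvg_mu => //.
    - by rewrite ltey_eq fin_num_measure.
    - by rewrite B0.
    - move=> m n mn; apply/subsetPset => x [Ux nGx]; split=> //.
      apply: contra_not nGx => -[i /= im Fix]; exists i => //=.
      exact: leq_trans mn.
  by rewrite B0 measure0 => /fine_cvg.
have MB : M (B n) @[n --> \oo] --> (0 : R).
  apply: (@squeeze_cvgr _ _ _ _ (fun=> 0) (fun n => fine (lam (B n)))) => //.
    by apply: nearW => n; rewrite M_ge0 M_le.
  exact: cvg_cst.
rewrite (_ : (fun _ => _) = fun n => (M U - M (B n))%:E); last first.
  by apply/funext => n; rewrite nuG (GB n) addrK.
apply: cvg_EFin; first exact: nearW.
rewrite [X in _ --> X](_ : _ = M U - 0); last by rewrite subr0.
by apply: cvgB => //; exact: cvg_cst.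
Qed.

#[local] HB.instance Definition _ :=
  isMeasure.Build _ _ _ nu nu_set0 nu_ge0 nu_sigma_additive.

Let nu_fin : fin_num_fun nu. Proof. by move=> A mA. Qed.

#[local] HB.instance Definition _ := Measure_isFinite.Build _ _ _ nu nu_fin.

(** Countable additivity makes Radon-Nikodym applicable. On the set where the derivative [f] exceeds
    1, the integral of [f - 1] is [M A] minus the mass of [A], hence at most 0, so this set is null.
    Truncating [f] at 1 changes no integral and gives the bounds at every point. *)
Lemma dominated_density : exists g : T -> R,
  [/\ measurable_fun setT g, forall x, 0 <= g x <= 1 &
      forall A, measurable A -> M A = \int[lam]_(x in A) g x].
Proof.
have numu : nu `<< lam.
  apply/null_content_dominatesP => A mA lamA0.
  by apply/eqP; rewrite eq_le nu_ge0 andbT lee_fin (le_trans (M_le mA))// lamA0.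
pose f := Radon_Nikodym_SigmaFinite.f nu lam.
have f0 x : (0 <= f x)%E by exact: Radon_Nikodym_SigmaFinite.f_ge0.
have ffin x : f x \is a fin_num by exact: Radon_Nikodym_SigmaFinite.f_fin_num.
have fint : lam.-integrable setT f by exact: Radon_Nikodym_SigmaFinite.f_integrable.
have fE A : measurable A -> nu A = (\int[lam]_(x in A) f x)%E.
  exact: Radon_Nikodym_SigmaFinite.f_integral.
have mf := measurable_int _ fint.
pose g x := Num.min 1 (fine (f x)).
have mg : measurable_fun setT g.
  by apply: measurable_minr => //; exact: measurableT_comp.
pose A := [set x | (1%:E < f x)%E].
have mA : measurable A.
  rewrite -[A]setTI; apply: emeasurable_fun_o_infty => //.
exists g; split=> //.
  move=> x; rewrite /g ge_min lexx le_min ler01 fine_ge0//.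
move=> B mB.
have lamA0 : lam A = 0%E.
  have fA1 : (\int[lam]_(x in A) `|f x - 1%:E|%E = 0)%E.
    apply/eqP; rewrite eq_le integral_ge0// andbT.
    rewrite (eq_integral (fun x => f x - 1%:E)%E); last first.
      move=> x /set_mem /= fx1; rewrite gee0_abs//.
      by have := ltW fx1; rewrite -suber_ge0.
    have intA1 : lam.-integrable A (cst 1%:E).
      exact: finite_measure_integrable_cst.
    rewrite integralB//; last first.
      exact: (integrableS measurableT).
    rewrite integral_cst// mul1e -fE// sube_le0//.
    by rewrite -[leRHS]fineK ?fin_num_measure// lee_fin M_le.
  have mfA : measurable_fun A (fun x => f x - 1%:E)%E.
    by apply: emeasurable_funB => //; exact: measurable_funTS.
  have [N [mN N0 AN]] := (ae_eq_integral_abs lam mA mfA).1 fA1.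
  apply/eqP; rewrite -measure_le0 -N0 le_measure ?inE//.
  apply: subset_trans AN => x Ax fx1; move: (Ax); rewrite /A /=.
  by rewrite -sube_gt0 fx1//= ltxx.
have fEx : ae_eq lam setT f (EFin \o g).
  exists A; split=> // x /= nfx; rewrite /A /= ltNge; apply/negP => fx1.
  apply: nfx => _; rewrite /g min_r ?fineK//.
  by rewrite -lee_fin fineK.
rewrite /Rintegral (_ : (\int[lam]_(x in B) (g x)%:E = nu B)%E)// fE//.
apply: ae_eq_integral => //.
- by apply: measurable_funTS; exact: measurableT_comp.
- exact: measurable_funTS.
- exact/ae_eq_sym/(ae_eq_subset _ fEx).
Qed.

End dominated_density.

(** * The compact set of plans *)

Section plan_functionals.
Context d (T : measurableType d) (R : realType) (I : finType) (L : Type).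
Variables (lam : {finite_measure set T -> \bar R}).
Variables (w : L -> T -> R) (b : I -> L -> R).
Local Notation V := (prod_topology (fun _ : I * (T -> R) => R)).
Implicit Types (i : I) (u v : T -> R) (P : V).

(* Encodes a decomposition [lam = \sum_i pi_i] with [\int w_l dpi_i = b_i l] by
   the functionals [u |-> \int u dpi_i], set to 0 outside bounded measurable
   functions so that a functional is determined by its meaningful values. *)
Definition plan_functional : set V := [set P | [/\
  forall i u, ~ bounded_measurable u -> P (i, u) = 0,
  forall i k u v, bounded_measurable u -> bounded_measurable v ->
    P (i, fun x => k * u x + v x) = k * P (i, u) + P (i, v),
  forall i u, bounded_measurable u -> (forall x, 0 <= u x) -> 0 <= P (i, u),
  forall u, bounded_measurable u -> \sum_i P (i, u) = \int[lam]_x u x &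
  forall i l, P (i, w l) = b i l]].

Section one_functional.
Variables (P : V) (planP : plan_functional P).

Let linP i k u v : bounded_measurable u -> bounded_measurable v ->
  P (i, fun x => k * u x + v x) = k * P (i, u) + P (i, v).
Proof. by case: planP => _ + _ _ _; exact. Qed.

Lemma plan_functional_ge0 i u : bounded_measurable u ->
  (forall x, 0 <= u x) -> 0 <= P (i, u).
Proof. by case: planP => _ _ + _ _; exact. Qed.

Lemma plan_functionalD i u v : bounded_measurable u -> bounded_measurable v ->
  P (i, fun x => u x + v x) = P (i, u) + P (i, v).
Proof.
by move=> bu bv; have := linP i 1 bu bv; under eq_fun do rewrite mul1r; rewrite mul1r.
Qed.

Lemma plan_functional0 i : P (i, fun=> 0) = 0.
Proof.
have b0 := @bounded_measurable_cst _ T R 0.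
have /eqP := plan_functionalD i b0 b0; under eq_fun do rewrite addr0.
by rewrite -subr_eq0 opprD addrA subrr sub0r oppr_eq0 => /eqP.
Qed.

Lemma plan_functionalZ i k u : bounded_measurable u ->
  P (i, fun x => k * u x) = k * P (i, u).
Proof.
move=> bu; have := linP i k bu (bounded_measurable_cst T 0).
by under eq_fun do rewrite addr0; rewrite plan_functional0 addr0.
Qed.

Lemma plan_functionalB i u v : bounded_measurable u -> bounded_measurable v ->
  P (i, fun x => u x - v x) = P (i, u) - P (i, v).
Proof.
move=> bu bv; have := linP i (-1) bv bu.
by under eq_fun do rewrite mulN1r addrC; rewrite mulN1r addrC.
Qed.

Lemma plan_functional_le i u v : bounded_measurable u -> bounded_measurable v ->
  (forall x, u x <= v x) -> P (i, u) <= P (i, v).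
Proof.
move=> bu bv uv; rewrite -subr_ge0 -plan_functionalB//.
apply: plan_functional_ge0; first exact: bounded_measurableB.
by move=> x; rewrite subr_ge0.
Qed.

Lemma plan_functional_le_integral i u : bounded_measurable u ->
  (forall x, 0 <= u x) -> P (i, u) <= \int[lam]_x u x.
Proof.
move=> bu u0; case: planP => _ _ _ <-// _; rewrite (bigD1 i)//= lerDl.
by apply: sumr_ge0 => j _; exact: plan_functional_ge0.
Qed.

(** The bound depends on [lam] only: it provides the segments containing all plan functionals, and
    it makes each of them continuous for the L1 norm. *)
Lemma plan_functional_norm_le i u : bounded_measurable u ->
  `|P (i, u)| <= \int[lam]_x `|u x|.
Proof.
move=> bu; have bnu := bounded_measurable_norm bu.
apply: le_trans (plan_functional_le_integral i bnu _); last by [].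
rewrite ler_norml; apply/andP; split; last first.
  by apply: plan_functional_le => // x; exact: ler_norm.
rewrite -mulN1r -plan_functionalZ//; apply: plan_functional_le => //.
  exact: bounded_measurableZ.
by move=> x; rewrite mulN1r lerNl -normrN ler_norm.
Qed.

End one_functional.

(** Each condition is an equality or a large inequality between continuous functions of finitely
    many coordinates, hence passes to the closure separately. *)
Lemma plan_functional_closed : closed plan_functional.
Proof.
move=> P clP; have cl Q : closed Q -> plan_functional `<=` Q -> Q P.
  by move=> cQ /closureS; move=> /(_ _ clP) /cQ.
split.
- by move=> i u bu; apply: (cl _ (@closed_proj_eq R _ (i, u) 0)) => Q [/(_ i u bu)].
- move=> i k u v bu bv; apply: (cl _ (@closed_proj_linear R _
    (i, fun x => k * u x + v x) (i, u) (i, v) k)) => Q [_ lin _ _ _].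
  exact: lin.
- move=> i u bu u0; apply: (cl _ (@closed_proj_ge R _ (i, u) 0)) => Q [_ _ ge0 _ _].
  exact: ge0.
- move=> u bu; apply: (cl _ (@closed_sum_proj_eq R _ _ _ (fun i => (i, u)) _)).
  by move=> Q [_ _ _ sumQ _]; exact: sumQ.
- move=> i l; apply: (cl _ (@closed_proj_eq R _ (i, w l) _)) => Q [_ _ _ _ Qw].
  exact: Qw.
Qed.

Lemma plan_functional_compact : compact plan_functional.
Proof.
pose r (j : I * (T -> R)) := \int[lam]_x `|j.2 x|.
pose B : set V := [set P | forall j, `[- r j, r j]%classic (P j)].
have coB : compact B.
  apply: (@tychonoff _ (fun=> R) (fun j => `[- r j, r j]%classic)) => j.
  exact: segment_compact.
apply: (subclosed_compact plan_functional_closed coB) => P planP [i u] /=.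
rewrite in_itv/= -ler_norml.
have [bu|nbu] := pselect (bounded_measurable u).
  exact: plan_functional_norm_le.
(* At a function that is not bounded measurable the coordinate is 0, which lies in the segment
   because its half-length is nonnegative whatever the function. *)
have [/(_ i u nbu) -> _ _ _ _] := planP.
by rewrite normr0; exact: Rintegral_ge0.
Qed.

End plan_functionals.

(** * Densities of plan functionals *)

Section plan_density.
Import HBSimple.
Context d (T : measurableType d) (R : realType) (I : finType) (L : Type).
Variables (lam : {finite_measure set T -> \bar R}).
Variables (w : L -> T -> R) (b : I -> L -> R).
Local Notation V := (prod_topology (fun _ : I * (T -> R) => R)).
Variables (P : V) (planP : plan_functional lam w b P).

Lemma bounded_measurable_sfun (f : {sfun T >-> R}) : bounded_measurable f.
Proof.
split=> //; have [M [_ fM]] := simple_bounded f.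
by exists (M + 1) => x; apply: fM => //; rewrite ltrDl.
Qed.

Lemma plan_functional_sum i (s : seq R) (u : R -> T -> R) :
  (forall r, bounded_measurable (u r)) ->
  P (i, fun x => \sum_(r <- s) r * u r x) = \sum_(r <- s) r * P (i, u r).
Proof.
move=> bu; elim: s => [|r s IH].
  rewrite big_nil -[RHS](plan_functional0 planP i); congr (P (_, _)).
  by apply/funext => x; rewrite big_nil.
rewrite big_cons -IH -(plan_functionalZ planP)// -(plan_functionalD planP).
- by congr (P (_, _)); apply/funext => x; rewrite big_cons.
- exact: bounded_measurableZ.
- by apply: bounded_measurable_sum => ?; exact: bounded_measurableZ.
Qed.

(** The values on indicators form a dominated additive set function, which has a density. The
    formula extends to simple functions by linearity, and to bounded measurable ones because both
    sides are bounded by the L1 norm. *)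
Lemma plan_density : exists g : I -> T -> R,
  [/\ forall i, measurable_fun setT (g i), forall i x, 0 <= g i x <= 1 &
    forall i u, bounded_measurable u ->
      P (i, u) = \int[lam]_x (u x * g i x)].
Proof.
suff : forall i, exists g : T -> R, [/\ measurable_fun setT g,
    forall x, 0 <= g x <= 1 & forall u, bounded_measurable u ->
      P (i, u) = \int[lam]_x (u x * g x)].
  by move=> /choice[g gP]; exists g; split=> i; case: (gP i).
move=> i; pose M (A : set T) : R := P (i, \1_A).
(* Required for every set; on a non-measurable one the value is 0 by the convention in
   [plan_functional]. *)
have M_ge0 A : 0 <= M A.
  have [bA|nbA] := pselect (bounded_measurable (\1_A : T -> R)).
    by apply: (plan_functional_ge0 planP).
  by rewrite /M; case: planP => ->.
have M_le A : measurable A -> M A <= fine (lam A).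
  move=> mA; rewrite -Rintegral_indic//.
  apply: (plan_functional_le_integral planP) => //.
  exact: bounded_measurable_indic.
have M_add A B : measurable A -> measurable B -> A `&` B = set0 ->
    M (A `|` B) = M A + M B.
  move=> mA mB AB; rewrite -(plan_functionalD planP);
    [|exact: bounded_measurable_indic..].
  congr (P (_, _)); apply/funext => x; rewrite !indicE in_setU.
  have [xA|] := boolP (x \in A); last by rewrite add0r.
  have [xB|] := boolP (x \in B); last by rewrite addr0.
  have : (A `&` B) x by split; exact: set_mem.
  by rewrite AB.
have [g [mg g01 gE]] := dominated_density M_ge0 M_le M_add.
have bg : bounded_measurable g.
  split=> //; exists 1 => x; have /andP[g0 g1] := g01 x.
  by rewrite ger0_norm.
exists g; split=> // u bu; apply/eqP; rewrite -subr_eq0 -normr_le0.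
have int f : bounded_measurable f -> lam.-integrable setT (EFin \o f).
  by move=> bf; exact: bounded_measurable_integrable.
have sfunE (f : {sfun T >-> R}) : P (i, f : T -> R) = \int[lam]_x (f x * g x).
  have fE : (f : T -> R) = fun x => \sum_(r <- fset_set (range f))
      r * \1_(f @^-1` [set r]) x.
    by apply/funext => x; rewrite {1}fimfunE fsbig_finite.
  rewrite [in LHS]fE plan_functional_sum; last first.
    by move=> r; apply: bounded_measurable_indic.
  have intr r : lam.-integrable setT
      (EFin \o (fun x => r * \1_(f @^-1` [set r]) x * g x)).
    apply/int/bounded_measurableM => //.
    exact/bounded_measurableZ/bounded_measurable_indic.
  rewrite [in RHS]fE /Rintegral.
  under [in RHS]eq_integral do rewrite mulr_suml -sumEFin.
  rewrite integral_sum// -sum_fine//; last first.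
    by move=> r _; apply: integrable_fin_num => //; exact: intr.
  apply: eq_bigr => r _.
  have mr : measurable (f @^-1` [set r]) by [].
  rewrite -/(M _) gE// -Rintegral_indicM -RintegralZl//.
    by congr fine; apply: eq_integral => x _; rewrite mulrA.
  exact/int/bounded_measurableM/bg/bounded_measurable_indic.
have [phi [_ _ phi0]] := approximation_sfun_integrable measurableT (int _ bu).
(* The two sides agree on the simple function [phi n], and each is at most the L1 distance at
   [u - phi n]; hence [X / 2] lies below a sequence tending to 0. *)
set X := `|_|; suff : X / 2 <= 0 by rewrite pmulr_lle0.
rewrite -lee_fin; apply: cvge_to_ge phi0 _; apply: nearW => n.
have bphi := bounded_measurable_sfun (phi n).
have bD := bounded_measurableB bu bphi.
have bnD := bounded_measurable_norm bD.
have -> : (\int[lam]_x `|(u x)%:E - (phi n x)%:E| =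
    (\int[lam]_x `|u x - phi n x|)%:E)%E.
  by rewrite /Rintegral fineK//; apply: integrable_fin_num => //; exact: int.
rewrite lee_fin ler_pdivrMr// mulr_natr mulr2n.
have -> : X = `|P (i, fun x => u x - phi n x) -
    \int[lam]_x ((u x - phi n x) * g x)|.
  rewrite (plan_functionalB planP)// sfunE /X.
  have -> : \int[lam]_x ((u x - phi n x) * g x) =
      \int[lam]_x (u x * g x) - \int[lam]_x (phi n x * g x).
    rewrite -RintegralB//; [|by apply: int; exact: bounded_measurableM..].
    by apply: eq_Rintegral => x _; rewrite mulrBl.
  by congr `|_|; rewrite opprB addrA subrK.
apply: le_trans (ler_normB _ _) _; apply: lerD.
  exact: plan_functional_norm_le planP _ _ bD.
apply: le_trans (le_normr_Rintegral _ _) _ => //.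
  by apply: int; exact: bounded_measurableM.
apply: le_Rintegral => //.
- by apply: int; apply: bounded_measurable_norm; exact: bounded_measurableM.
- exact: int.
- move=> x _; have /andP[g0 g1] := g01 x.
  by rewrite normrM ler_piMr// ger0_norm.
Qed.

End plan_density.

(** * Functionals of genuine decompositions *)

Section plans_of_measures.
Context d (T : measurableType d) (R : realType) (I : finType) (L : Type).
Variables (lam : {finite_measure set T -> \bar R}).
Variables (w : L -> T -> R) (b : I -> L -> R).
Hypothesis bw : forall l, bounded_measurable (w l).
Local Notation V := (prod_topology (fun _ : I * (T -> R) => R)).

Definition functional_of (E : I -> (T -> R) -> R) : V :=
  fun j => if pselect (bounded_measurable j.2) then E j.1 j.2 else 0.

Lemma functional_ofE E i u : bounded_measurable u ->
  functional_of E (i, u) = E i u.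
Proof. by rewrite /functional_of; case: pselect. Qed.

Lemma plan_functional_of (E : I -> (T -> R) -> R) :
  (forall i k u v, bounded_measurable u -> bounded_measurable v ->
    E i (fun x => k * u x + v x) = k * E i u + E i v) ->
  (forall i u, bounded_measurable u -> (forall x, 0 <= u x) -> 0 <= E i u) ->
  (forall u, bounded_measurable u -> \sum_i E i u = \int[lam]_x u x) ->
  (forall i l, E i (w l) = b i l) ->
  plan_functional lam w b (functional_of E).
Proof.
move=> lin ge0 sumE Ew; split.
- by move=> i u nbu; rewrite /functional_of; case: pselect.
- move=> i k u v bu bv; rewrite !functional_ofE//; first exact: lin.
  exact: bounded_measurableZD.
- by move=> i u bu u0; rewrite functional_ofE//; exact: ge0.
- move=> u bu; rewrite -sumE//; apply: eq_bigr => i _.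
  by rewrite functional_ofE.
- by move=> i l; rewrite functional_ofE.
Qed.

Definition decomposition (pi : I -> {finite_measure set T -> \bar R}) :=
  (forall A, measurable A -> (\sum_i pi i A = lam A)%E) /\
  forall i l, \int[pi i]_x w l x = b i l.

(** Integration against a finite sum of measures is available for sums over ordinals, so [I] is
    enumerated; [i0] is the default value of the enumeration. *)
Lemma decomposition_ge0_integral (i0 : I) pi (f : T -> \bar R) :
  decomposition pi -> measurable_fun setT f -> (forall x, (0 <= f x)%E) ->
  (\sum_i \int[pi i]_x f x = \int[lam]_x f x)%E.
Proof.
move=> [sumpi _] mf f0.
pose m_ (n : nat) : {measure set T -> \bar R} := pi (nth i0 (enum I) n).
have sumE (F : {measure set T -> \bar R} -> \bar R) :
    (\sum_i F (pi i) = \sum_(n < size (enum I)) F (m_ n))%E.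
  by rewrite -big_enum (big_nth i0) big_mkord.
rewrite (sumE (fun m => \int[m]_x f x)%E) -ge0_integral_measure_sum//.
apply: eq_measure_integral => A mA _.
transitivity (\sum_i pi i A)%E; last exact: sumpi.
by rewrite (sumE (fun m => m A)).
Qed.

(** Adding the bound [r] of [u] reduces the claim to nonnegative functions, namely [u + r] and the
    constant [r]. *)
Lemma decomposition_integral (i0 : I) pi u : decomposition pi ->
  bounded_measurable u -> \sum_i \int[pi i]_x u x = \int[lam]_x u x.
Proof.
move=> dpi bu.
have ge0E v : bounded_measurable v -> (forall x, 0 <= v x) ->
    \sum_i \int[pi i]_x v x = \int[lam]_x v x.
  move=> bv v0; rewrite /Rintegral sum_fine; last first.
    by move=> i _; apply: integrable_fin_num => //; exact: bounded_measurable_integrable.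
  congr fine; apply: (decomposition_ge0_integral i0 dpi) => //.
  by apply/measurable_EFinP; case: bv.
have [mu [r ur]] := bu.
have br := bounded_measurable_cst T r.
have r0 : 0 <= r by rewrite (le_trans _ (ur point)).
have bur := bounded_measurableD bu br.
have intE (m : {finite_measure set T -> \bar R}) :
    \int[m]_x u x = \int[m]_x (u x + r) - \int[m]_x r.
  rewrite -RintegralB//; [|exact: bounded_measurable_integrable..].
  by apply: eq_Rintegral => x _; rewrite addrK.
rewrite intE -!ge0E//; first by rewrite -sumrB; apply: eq_bigr => i _.
by move=> x; rewrite -lerBlDr sub0r; have := ur x; rewrite ler_norml => /andP[].
Qed.

Lemma plan_functional_decomposition (i0 : I) pi : decomposition pi ->
  plan_functional lam w b (functional_of (fun i u => \int[pi i]_x u x)).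
Proof.
move=> dpi; apply: plan_functional_of.
- move=> i k u v bu bv; rewrite -RintegralZl//; last exact: bounded_measurable_integrable.
  rewrite -RintegralD//; apply: bounded_measurable_integrable => //.
  exact: bounded_measurableZ.
- by move=> i u bu u0; apply: Rintegral_ge0.
- by move=> u bu; exact: decomposition_integral.
- by case: dpi.
Qed.

End plans_of_measures.

(** * The cost as a supremum of continuous functionals *)

Section truncated_cost.
Context d (T : measurableType d) (R : realType) (I : finType) (L : Type).
Variables (lam : {finite_measure set T -> \bar R}).
Variables (w : L -> T -> R) (b : I -> L -> R) (c : I -> T -> R).
Hypothesis mc : forall i, measurable_fun setT (c i).
Hypothesis c0 : forall i x, 0 <= c i x.
Local Notation V := (prod_topology (fun _ : I * (T -> R) => R)).

Definition truncation i (n : nat) (x : T) : R := Num.min (c i x) n%:R.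

Lemma truncation_ge0 i n x : 0 <= truncation i n x.
Proof. by rewrite /truncation le_min c0/=. Qed.

Lemma bounded_measurable_truncation i n : bounded_measurable (truncation i n).
Proof.
split; first exact: measurable_minr.
by exists n%:R => x; rewrite ger0_norm ?truncation_ge0// ge_min lexx orbT.
Qed.

Lemma truncation_nd i x m n : (m <= n)%N -> truncation i m x <= truncation i n x.
Proof. by move=> mn; rewrite le_min2// ler_nat. Qed.

Lemma truncation_cvg i x : (truncation i n x)%:E @[n --> \oo] --> (c i x)%:E.
Proof.
apply: cvg_near_cst; near=> n; congr EFin; rewrite /truncation min_l//.
rewrite (le_trans _ (_ : (Num.truncn (c i x)).+1%:R <= _))//.
  by rewrite ltW// truncnS_gt.
by rewrite ler_nat; near: n; exact: nbhs_infty_ge.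
Unshelve. all: by end_near. Qed.

(** Functionals are only meaningful at bounded functions, so the cost is defined through its
    truncations. For functionals given by measures this is the actual cost, by monotone
    convergence. *)
Definition plan_functional_cost (P : V) : \bar R :=
  ereal_sup (range (fun n => (\sum_i P (i, truncation i n))%:E)).

Lemma plan_functional_cost_closed (r : \bar R) :
  closed [set P | (plan_functional_cost P <= r)%E].
Proof.
rewrite (_ : [set _ | _] = \bigcap_n
    [set P : V | ((\sum_i P (i, truncation i n))%:E <= r)%E]).
  apply: closed_bigI => n _.
  exact: (@closed_sum_proj_le R _ _ _ (fun i => (i, truncation i n))).
apply/seteqP; split=> P /=.
  by move=> Pr n _ /=; apply: le_trans Pr; apply: ereal_sup_ubound; exists n.
by move=> Pr; apply: ge_ereal_sup => _ [n _ <-]; exact: Pr.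
Qed.

Lemma plan_functional_cost_cvg P : plan_functional lam w b P ->
  (\sum_i P (i, truncation i n))%:E @[n --> \oo] --> plan_functional_cost P.
Proof.
move=> planP; apply: ereal_nondecreasing_cvgn => m n mn.
rewrite lee_fin; apply: ler_sum => i _; apply: (plan_functional_le planP).
- exact: bounded_measurable_truncation.
- exact: bounded_measurable_truncation.
- by move=> x; exact: truncation_nd.
Qed.

Lemma plan_functional_cost_gt P : (-oo < plan_functional_cost P)%E.
Proof.
apply: (@lt_le_trans _ _ (\sum_i P (i, truncation i 0))%:E); first exact: ltNyr.
by apply: ereal_sup_ubound; exists 0.
Qed.

(** A supremum is not affine in general; here it is the limit of an increasing sequence of affine
    functions. The limit of the sums is the sum of the limits because no value is [-oo]. *)
Lemma plan_functional_cost_midpoint M N P : plan_functional lam w b M ->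
  plan_functional lam w b N -> plan_functional lam w b P -> midpoint M N P ->
  (plan_functional_cost M + plan_functional_cost N =
   plan_functional_cost P + plan_functional_cost P)%E.
Proof.
have def Q Q' : (plan_functional_cost Q +? plan_functional_cost Q')%E.
  have := plan_functional_cost_gt Q; have := plan_functional_cost_gt Q'.
  by case: (plan_functional_cost Q) => //; case: (plan_functional_cost Q').
move=> pM pN pP MNP.
have cM := plan_functional_cost_cvg pM.
have cN := plan_functional_cost_cvg pN.
have cP := plan_functional_cost_cvg pP.
have E : (fun n => (\sum_i M (i, truncation i n))%:E +
      (\sum_i N (i, truncation i n))%:E)%E =
    (fun n => (\sum_i P (i, truncation i n))%:E +
      (\sum_i P (i, truncation i n))%:E)%E.
  apply/funext => n; rewrite -!EFinD -!big_split/=; congr EFin.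
  by apply: eq_bigr => i _; exact: MNP.
have cMN := cvgeD (def M N) cM cN; have cPP := cvgeD (def P P) cP cP.
have FF : Filter (\oo : set_system nat) by exact _.
by move: (cMN FF); rewrite E => {}cMN; exact: (cvg_unique _ cMN (cPP FF)).
Qed.

End truncated_cost.

(** * Extreme plans are induced by maps *)

Section bang_bang.
Context d (T : measurableType d) (R : realType) (I : finType) (L : Type).
Variables (lam : {finite_measure set T -> \bar R}).
Variables (w : L -> T -> R) (b : I -> L -> R).
Hypothesis bw : forall l, bounded_measurable (w l).
Hypothesis divisible : forall A, measurable A -> exists B,
  [/\ measurable B, B `<=` A & exists2 al : R, 0 < al < 1 &
    forall l, \int[lam]_(x in B) w l x = al * \int[lam]_(x in A) w l x].
Local Notation V := (prod_topology (fun _ : I * (T -> R) => R)).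

Section extreme_density.
Variables (P : V) (g : I -> T -> R).
Hypothesis planP : plan_functional lam w b P.
Hypothesis extremeP : forall M N, plan_functional lam w b M ->
  plan_functional lam w b N -> midpoint M N P -> M = P.
Hypothesis mg : forall i, measurable_fun setT (g i).
Hypothesis g01 : forall i x, 0 <= g i x <= 1.
Hypothesis gE : forall i u, bounded_measurable u ->
  P (i, u) = \int[lam]_x (u x * g i x).

Let bg i : bounded_measurable (g i).
Proof.
split=> //; exists 1 => x; have /andP[g0 g1] := g01 i x.
by rewrite ger0_norm.
Qed.

Let int u A : measurable A -> bounded_measurable u ->
  lam.-integrable A (EFin \o u).
Proof. by move=> mA bu; exact: bounded_measurable_integrable. Qed.

Section perturbation.
Variables (h : T -> R) (s : I -> R).
Hypothesis bh : bounded_measurable h.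
Hypothesis wh : forall l, \int[lam]_x (w l x * h x) = 0.
Hypothesis s0 : \sum_i s i = 0.

(** The density of component [i] moves by [t * s i * h]. The constraints survive since [h] is
    orthogonal to every [w l], and the total mass since the weights [s] sum to 0; only positivity
    has to be assumed. *)
Lemma perturbed_plan_functional (t : R) :
  (forall i x, 0 <= g i x + t * s i * h x) ->
  plan_functional lam w b
    (functional_of (fun i u => P (i, u) + t * s i * \int[lam]_x (u x * h x))).
Proof.
move=> ge0; case: (planP) => _ lin _ sumP Pw; apply: (plan_functional_of bw).
- move=> i k u v bu bv; rewrite lin//.
  have -> : \int[lam]_x ((k * u x + v x) * h x) =
      k * \int[lam]_x (u x * h x) + \int[lam]_x (v x * h x).
    have buh := bounded_measurableM bu bh; have bvh := bounded_measurableM bv bh.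
    rewrite -RintegralZl//; last exact: int.
    rewrite -RintegralD//; last 2 first.
    - exact/int/bounded_measurableZ.
    - exact: int.
    by apply: eq_Rintegral => x _; rewrite mulrDl mulrA.
  rewrite mulrDr mulrDr addrACA; congr (_ + _ + _); exact: mulrCA.
- move=> i u bu u0; rewrite gE//.
  have -> : \int[lam]_x (u x * g i x) + t * s i * \int[lam]_x (u x * h x) =
      \int[lam]_x (u x * (g i x + t * s i * h x)).
    have buh := bounded_measurableM bu bh.
    rewrite -RintegralZl//; last exact: int.
    rewrite -RintegralD//; last 2 first.
    - exact/int/bounded_measurableM.
    - exact/int/bounded_measurableZ.
    by apply: eq_Rintegral => x _; rewrite mulrDr mulrCA.
  by apply: Rintegral_ge0 => x _; rewrite mulr_ge0.
- move=> u bu; rewrite big_split/= sumP// -mulr_suml -mulr_sumr s0.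
  by rewrite mulr0 mul0r addr0.
- by move=> i l; rewrite Pw wh mulr0 addr0.
Qed.

(** The extreme point [P] is the midpoint of its perturbations with [t = 1] and [t = -1], so both
    coincide with [P] and the perturbation vanishes on every test function. *)
Lemma perturbation0 i u : bounded_measurable u -> s i != 0 ->
  (forall i x, `|s i * h x| <= g i x) -> \int[lam]_x (u x * h x) = 0.
Proof.
move=> bu si0 sh.
pose Q t := functional_of (fun i u => P (i, u) + t * s i * \int[lam]_x (u x * h x)).
have planQ t : `|t| <= 1 -> plan_functional lam w b (Q t).
  move=> t1; apply: perturbed_plan_functional => k x.
  rewrite -lerBlDr sub0r; apply: le_trans (ler_norm _) _.
  rewrite normrN -mulrA normrM; apply: le_trans (sh k x).
  by rewrite ler_piMl.
have /(congr1 (fun M => M (i, u))) : Q 1 = P.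
  apply: (extremeP (N := Q (-1))); [by apply: planQ; rewrite normr1|
    by apply: planQ; rewrite normrN normr1|].
  case=> k v; rewrite /Q /functional_of; case: pselect => /= [bv|nbv].
    by rewrite mul1r mulN1r mulNr addrACA subrr addr0.
  by case: planP => ->//; rewrite addr0.
rewrite /Q functional_ofE// mul1r => /eqP.
by rewrite -subr_eq0 addrAC subrr add0r mulf_eq0 (negbTE si0) => /eqP.
Qed.

End perturbation.

Lemma extreme_density_disjoint i j : i != j ->
  lam [set x | 0 < g i x /\ 0 < g j x] = 0%E.
Proof.
move=> ij; pose A n := [set x | n.+1%:R^-1 <= g i x /\ n.+1%:R^-1 <= g j x].
have mge k n : measurable [set x | n.+1%:R^-1 <= g k x].
  rewrite -[X in measurable X]setTI.
  rewrite (_ : [set x | _] = g k @^-1` `[n.+1%:R^-1, +oo[%classic).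
    by apply: mg => //; exact: measurable_itv.
  by apply/seteqP; split=> x /=; rewrite in_itv/= andbT.
have mA n : measurable (A n) by exact: (measurableI _ _ (mge i n) (mge j n)).
have AE : [set x | 0 < g i x /\ 0 < g j x] = \bigcup_n A n.
  apply/seteqP; split=> [x /= [gi gj]|x [n _ [ni nj]] /=]; last first.
    by split; [apply: lt_le_trans ni|apply: lt_le_trans nj]; rewrite invr_gt0.
  have [n ng] : exists n, n.+1%:R^-1 <= Num.min (g i x) (g j x).
    have g0 : 0 < Num.min (g i x) (g j x) by rewrite lt_min gi.
    exists (Num.truncn (Num.min (g i x) (g j x))^-1).
    by rewrite invf_ple ?posrE// ltW// truncnS_gt.
  by exists n => //; move: ng; rewrite le_min => /andP[].
suff A0 n : lam (A n) = 0%E.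
  rewrite AE; apply/negligibleP; first exact: bigcupT_measurable.
  apply: negligible_bigcup => n; exists (A n); split=> //; exact: A0.
have [B [mB BA [al /andP[al0 al1] wB]]] := divisible (mA n).
pose h x := \1_B x - al * \1_(A n) x : R.
have bB := bounded_measurable_indic R mB.
have bA := bounded_measurable_indic R (mA n).
have bh : bounded_measurable h.
  exact: (bounded_measurableB bB (bounded_measurableZ al bA)).
(* Mass is transferred from component [j] to component [i]. Since [h] vanishes off [A n] and is at
   most 1 in absolute value, the factor [n.+1%:R^-1], a lower bound of both densities on [A n],
   keeps the perturbation below them. *)
pose s k : R := n.+1%:R^-1 * ((k == i)%:R - (k == j)%:R).
have hE u : bounded_measurable u -> \int[lam]_x (u x * h x) =
    \int[lam]_(x in B) u x - al * \int[lam]_(x in A n) u x.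
  move=> bu; rewrite -[X in X - _]Rintegral_indicM -[X in al * X]Rintegral_indicM.
  rewrite -RintegralZl//; last exact/int/bounded_measurableM.
  rewrite -RintegralB//; last 2 first.
  - exact/int/bounded_measurableM.
  - exact/int/bounded_measurableZ/bounded_measurableM.
  apply: eq_Rintegral => x _; rewrite mulrBr mulrC; congr (_ - _).
  by rewrite mulrCA [u x * _]mulrC.
have h0 u : bounded_measurable u -> \int[lam]_x (u x * h x) = 0.
  move=> bu; apply: (@perturbation0 h s bh _ _ i) => //.
  - by move=> l; rewrite hE// wB subrr.
  - have sum1 k0 : \sum_(k : I) (k == k0)%:R = 1 :> R.
      rewrite (bigD1 k0)//= eqxx big1 ?addr0// => k.
      by move=> /negbTE ->.
    by rewrite -mulr_sumr sumrB !sum1 subrr mulr0.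
  - by rewrite /s eqxx (negbTE ij) subr0 mulr1 invr_eq0 pnatr_eq0.
  - move=> k x; have [xA|xA] := pselect (A n x); last first.
      have xB : ~ B x by move=> /BA.
      rewrite /h !indicE !memNset// mulr0 subrr mulr0 normr0.
      by have /andP[] := g01 k x.
    have h1 : `|h x| <= 1.
      rewrite /h !indicE (mem_set xA) mulr1 ler_norml; apply/andP.
      by case: (x \in B) => /=; rewrite ?mulr0n ?mulr1n; split; lra.
    case: xA => gi gj; rewrite /s !normrM gtr0_norm ?invr_gt0//.
    have nh : n.+1%:R^-1 * `|h x| <= n.+1%:R^-1 by rewrite ler_piMr ?invr_ge0.
    have [->|ki] := eqVneq k i.
      by rewrite (negbTE ij) subr0 normr1 mulr1 (le_trans nh).
    have [->|kj] := eqVneq k j.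
      by rewrite sub0r normrN normr1 mulr1 (le_trans nh).
    by rewrite subrr normr0 mulr0 mul0r; have /andP[] := g01 k x.
(* Testing with the indicator of [B] gives (1 - al) lam(B) = 0, so [B] is null because al < 1;
   testing with that of [A n] gives lam(B) = al lam(A n), so [A n] is null because al > 0. *)
have := h0 _ bB; rewrite hE// => B0.
have := h0 _ bA; rewrite hE// => A0.
have indE C D : measurable C -> measurable D -> C `<=` D ->
    \int[lam]_(x in C) \1_D x = fine (lam C) :> R.
  move=> mC mD CD; rewrite (@eq_Rintegral _ _ _ _ _ (fun=> 1)).
    by rewrite Rintegral_cst// mul1r.
  by move=> x /set_mem /CD Dx; rewrite indicE mem_set.
have BAE : \int[lam]_(x in A n) \1_B x = fine (lam B) :> R.
  rewrite -Rintegral_indic// Rintegral_mkcond; apply: eq_Rintegral => x _.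
  rewrite patchE; case: ifPn => // xA; rewrite indicE memNset//.
  by move=> /BA /mem_set; rewrite (negbTE xA).
rewrite indE// BAE in B0; rewrite !indE// in A0.
have lamB0 : fine (lam B) = 0.
  move: B0; rewrite -[X in X - _]mul1r -mulrBl => /eqP; rewrite mulf_eq0.
  by rewrite subr_eq0 gt_eqF//= => /eqP.
have : fine (lam (A n)) = 0.
  move: A0; rewrite lamB0 sub0r => /eqP.
  by rewrite oppr_eq0 mulf_eq0 gt_eqF//= => /eqP.
by move=> fA0; rewrite -[lam _]fineK ?fin_num_measure// fA0.
Qed.

(** The mass constraint, tested on indicators, says that the sum of the densities and the constant 1
    have equal integrals over every measurable set. *)
Lemma extreme_density_sum : {ae lam, forall x, \sum_i g i x = 1}.
Proof.
have bs : bounded_measurable (fun x => \sum_i g i x).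
  exact: bounded_measurable_sum.
have b1 := bounded_measurable_cst T (1 : R).
have : ae_eq lam setT (EFin \o (fun x => \sum_i g i x)) (EFin \o (fun=> 1)).
  apply: integral_ae_eq => //; first exact: int.
    by apply/measurable_EFinP; case: b1.
  move=> A _ mA.
  have finE u : bounded_measurable u ->
      (\int[lam]_(x in A) (u x)%:E = (\int[lam]_x (\1_A x * u x))%:E)%E.
    move=> bu; rewrite Rintegral_indicM /Rintegral fineK//.
    by apply: integrable_fin_num => //; exact: int.
  rewrite (finE _ bs) (finE _ b1); congr EFin.
  have bA := bounded_measurable_indic R mA.
  transitivity (\int[lam]_x \1_A x); last first.
    by apply: eq_Rintegral => x _; rewrite mulr1.
  case: (planP) => _ _ _ sumP _; rewrite -[RHS]sumP//.
  under [RHS]eq_bigr do rewrite gE//.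
  rewrite /Rintegral sum_fine; last first.
    by move=> i _; apply: integrable_fin_num => //; exact/int/bounded_measurableM.
  rewrite -integral_sum//; last first.
    by move=> i; exact/int/bounded_measurableM.
  by congr fine; apply: eq_integral => x _; rewrite sumEFin mulr_sumr.
by apply: filterS => x /(_ Logic.I) /= [].
Qed.

(** Almost everywhere the densities sum to 1 and at most one is positive, so exactly one equals 1
    and the others vanish. [S] picks an index of positive density, and takes the value [i0] where
    there is none. *)
Lemma extreme_density_selection (i0 : I) : exists S : T -> I,
  (forall i, measurable (S @^-1` [set i])) /\
  forall i u, bounded_measurable u ->
    P (i, u) = \int[lam]_(x in S @^-1` [set i]) u x.
Proof.
pose phi (v : {ffun I -> bool}) := odflt i0 [pick i | v i].
pose v x := [ffun i => 0 < g i x].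
exists (phi \o v); have mS i : measurable ((phi \o v) @^-1` [set i]).
  (* The selection depends on [x] only through the pattern of positive densities, which takes
     finitely many values, each on a measurable set. *)
  rewrite (_ : _ @^-1` _ = \bigcup_(u in [set u | phi u = i])
      \bigcap_(k in [set: I]) [set x | (0 < g k x) = u k]); last first.
    apply/seteqP; split=> [x /= xi|x [u /= ui xu]].
      by exists (v x) => // k _ /=; rewrite ffunE.
    rewrite -ui; congr phi; apply/ffunP => k; rewrite ffunE; exact: xu.
  apply: fin_bigcup_measurable; first exact: finite_finset.
  move=> u _; apply: fin_bigcap_measurable; first exact: finite_finset.
  move=> k _; rewrite (_ : [set x | _] =
    if u k then g k @^-1` `]0, +oo[%classic else g k @^-1` `]-oo, 0]%classic).
    case: (u k); rewrite -[X in measurable X]setTI; apply: mg => //;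
      exact: measurable_itv.
  apply/seteqP; split=> x /=; case: (u k) => /=; rewrite in_itv/= ?andbT// leNgt.
    by move=> ->.
  by move/negbTE.
split=> // i u bu; rewrite gE// -[RHS]Rintegral_indicM.
have mSi := bounded_measurable_indic R (mS i).
rewrite /Rintegral; congr fine; apply: ae_eq_integral => //.
- by apply/measurable_EFinP; case: (bounded_measurableM bu (bg i)).
- by apply/measurable_EFinP; case: (bounded_measurableM mSi bu).
have mpos k : measurable [set x | 0 < g k x].
  rewrite -[X in measurable X]setTI.
  rewrite (_ : [set x | _] = g k @^-1` `]0, +oo[%classic).
    by apply: mg => //; exact: measurable_itv.
  by apply/seteqP; split=> x /=; rewrite in_itv/= andbT.
have dis : {ae lam, forall x, forall j k, j != k -> ~ (0 < g j x /\ 0 < g k x)}.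
  apply: filter_forall => j; apply: filter_forall => k.
  have [->|jk] := eqVneq j k; first exact: nearW.
  exists [set x | 0 < g j x /\ 0 < g k x]; split.
  - apply: (measurableI [set x | 0 < g j x] [set x | 0 < g k x]).
      exact: mpos.
    exact: mpos.
  - exact: extreme_density_disjoint.
  - by move=> x /= /not_implyP[_ /contrapT].
apply: filterS2 dis extreme_density_sum => x dis sum1 _.
congr EFin; rewrite mulrC; congr (_ * _).
have [k gk] : exists k, 0 < g k x.
  apply: contrapT => /forallNP g0; move: sum1; rewrite big1 => [/eqP|j _].
    by rewrite eq_sym oner_eq0.
  apply/eqP; rewrite eq_le leNgt; have /andP[-> _] := g01 j x.
  by rewrite andbT; apply/negP; exact: g0.
have gk0 j : j != k -> g j x = 0.
  move=> jk; apply/eqP; rewrite eq_le leNgt; have /andP[-> _] := g01 j x.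
  by rewrite andbT; apply/negP => gj; exact: (dis j k).
have phik : phi (v x) = k.
  rewrite /phi; case: pickP => [j|/(_ k)]; rewrite ffunE ?gk//= => gj.
  by apply/eqP/negPn/negP => /gk0 gj0; rewrite gj0 ltxx in gj.
have gk1 : g k x = 1 by rewrite -sum1 (bigD1 k)//= big1 ?addr0.
have [->|ik] := eqVneq i k.
  by rewrite gk1 indicE mem_set.
rewrite gk0// indicE memNset//= phik => /esym ki.
by rewrite ki eqxx in ik.
Qed.

End extreme_density.

(** For the extreme minimizer, monotone convergence along the truncations identifies its functional
    cost with the cost of [S]. For a competitor, the truncations lie below [c], so its functional
    cost is at most its cost. *)
Theorem bang_bang (i0 : I) (c : I -> T -> R)
    (pi0 : I -> {finite_measure set T -> \bar R}) :
  (forall i, measurable_fun setT (c i)) -> (forall i x, 0 <= c i x) ->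
  decomposition lam w b pi0 ->
  exists S : T -> I, [/\ forall i, measurable (S @^-1` [set i]),
    forall i l, \int[lam]_(x in S @^-1` [set i]) w l x = b i l &
    forall pi, decomposition lam w b pi ->
      (\sum_i \int[lam]_(x in S @^-1` [set i]) (c i x)%:E <=
       \sum_i \int[pi i]_x (c i x)%:E)%E].
Proof.
move=> mc c0 dpi0.
pose K := plan_functional lam w b; pose J := plan_functional_cost (c : I -> T -> R).
have [P [planP Pmin extP]] : exists P, [/\ K P, forall N, K N -> (J P <= J N)%E &
    forall M N, K M -> K N -> midpoint M N P -> M = P].
  apply: extreme_minimizer.
  - exact: plan_functional_closed.
  - exact: plan_functional_compact.
  - exists (functional_of (fun i u => \int[pi0 i]_x u x)).
    exact: plan_functional_decomposition.
  - exact: plan_functional_cost_closed.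
  - by move=> M _; exact: plan_functional_cost_gt.
  - by move=> M N Q KM KN KQ; exact: (plan_functional_cost_midpoint mc c0 KM KN KQ).
have [g [mg g01 gE]] := plan_density planP.
have [S [mS SE]] := extreme_density_selection planP extP mg g01 gE i0.
exists S; split=> // [i l|pi dpi]; first by rewrite -SE//; case: planP.
have bt := bounded_measurable_truncation mc c0.
have t0 := truncation_ge0 c0.
have intt (m : {finite_measure set T -> \bar R}) A i n : measurable A ->
    (\int[m]_(x in A) (truncation c i n x)%:E =
    (\int[m]_(x in A) truncation c i n x)%:E)%E.
  move=> mA; rewrite /Rintegral fineK//.
  by apply: integrable_fin_num => //; exact: bounded_measurable_integrable.
have cvgS : (\sum_i \int[lam]_(x in S @^-1` [set i]) (truncation c i n x)%:E
    @[n --> \oo] --> \sum_i \int[lam]_(x in S @^-1` [set i]) (c i x)%:E)%E.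
  apply: cvg_nnesum => [i _|i _].
    by apply: nearW => n; apply: integral_ge0 => x _; rewrite lee_fin.
  rewrite (eq_integral (fun x => limn (fun n => (truncation c i n x)%:E))); last first.
    by move=> x _; apply/esym/cvg_lim => //; exact: truncation_cvg.
  apply: (@cvg_monotone_convergence _ _ _ lam _ (mS i)
    (fun n x => (truncation c i n x)%:E)).
  - by move=> n; apply/measurable_EFinP/measurable_funTS; case: (bt i n).
  - by move=> n x _; rewrite lee_fin.
  - by move=> x _ m n mn; rewrite lee_fin truncation_nd.
have cvgJ := plan_functional_cost_cvg mc c0 planP.
have -> : (\sum_i \int[lam]_(x in S @^-1` [set i]) (c i x)%:E = J P)%E.
  apply: (cvg_unique (@ereal_hausdorff R) cvgS).
  rewrite (_ : (fun n => _) = fun n => (\sum_i P (i, truncation c i n))%:E)//.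
  apply/funext => n; rewrite -sumEFin; apply: eq_bigr => i _.
  by rewrite intt// SE.
apply: le_trans (Pmin _ (plan_functional_decomposition bw i0 dpi)) _.
apply: ge_ereal_sup => _ [n _ <-]; rewrite -sumEFin; apply: lee_sum => i _.
rewrite functional_ofE// -intt//; apply: ge0_le_integral => //.
- by move=> x _; rewrite lee_fin.
- by apply/measurable_EFinP; case: (bt i n).
- exact/measurable_EFinP.
- by move=> x _; rewrite lee_fin /truncation ge_min lexx.
Qed.

End bang_bang.

(** * Bochner integrals and continuous functionals *)

Section integral_mono.
Local Open Scope ereal_scope.
Context d (T : measurableType d) (R : realType).
Variable mu : {measure set T -> \bar R}.
Import HBNNSimple.
Implicit Types (D E : set T) (f g : T -> \bar R).

(* No measurability: for non-measurable functions the integral is a lower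
   integral, which is still monotone. *)
Lemma ge0_subset_le_integral D E f g : D `<=` E ->
  (forall x, D x -> 0 <= f x) -> (forall x, E x -> 0 <= g x) ->
  (forall x, D x -> f x <= g x) ->
  \int[mu]_(x in D) f x <= \int[mu]_(x in E) g x.
Proof.
move=> DE f0 g0 fg; rewrite !ge0_integralE//.
have fg' x : (f \_ D) x <= (g \_ E) x.
  rewrite !patchE; case: ifPn => [/set_mem Dx|_].
    by rewrite mem_set; [exact: fg|exact: DE].
  by case: ifPn => // /set_mem; exact: g0.
apply: ereal_sup_le => _ [h /= hf <-]; exists h => // x.
exact: le_trans (hf x) (fg' x).
Qed.

End integral_mono.

Section finite_range.
Context d (T : measurableType d) (R : realType).
Variable mu : {finite_measure set T -> \bar R}.

(** [simple_function] for an arbitrary target: the pair of two simple functions is then a common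
    refinement of both. *)
Definition measurable_partition (U : choiceType) (p : T -> U) :=
  finite_set (range p) /\ forall u, measurable (p @^-1` [set u]).

Lemma measurable_partition_pair (U V : choiceType) (p : T -> U) (q : T -> V) :
  measurable_partition p -> measurable_partition q ->
  measurable_partition (fun x => (p x, q x)).
Proof.
move=> [fp mp] [fq mq]; split.
  apply: (sub_finite_set _ (finite_setX fp fq)) => _ [x _ <-].
  by split; exists x.
move=> [u v]; rewrite (_ : _ @^-1` _ = p @^-1` [set u] `&` q @^-1` [set v]).
  exact: measurableI.
by apply/seteqP; split=> x /= => [[-> ->]|[-> ->]].
Qed.

Variables (U : choiceType) (p : T -> U).
Hypothesis pp : measurable_partition p.
Let Z := fset_set (range p).
Let m A u := fine (mu (A `&` p @^-1` [set u])).

Let pZ x : p x \in Z.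
Proof. by rewrite in_fset_set ?inE; [exists x|case: pp]. Qed.

Lemma finite_rangeE (H : U -> R) x :
  H (p x) = \sum_(u <- Z) H u * \1_(p @^-1` [set u]) x.
Proof.
rewrite (bigD1_seq (p x))//= indicE mem_set// mulr1 big1 ?addr0// => u ux.
by rewrite indicE memNset ?mulr0//= => xu; rewrite xu eqxx in ux.
Qed.

Lemma bounded_measurable_finite_range (H : U -> R) :
  bounded_measurable (H \o p).
Proof.
rewrite (_ : H \o p = fun x => \sum_(u <- Z) H u * \1_(p @^-1` [set u]) x).
  apply: bounded_measurable_sum => u; apply: bounded_measurableZ.
  by apply: bounded_measurable_indic; case: pp.
by apply/funext => x; exact: finite_rangeE.
Qed.

Lemma Rintegral_finite_range A (H : U -> R) : measurable A ->
  \int[mu]_(x in A) H (p x) = \sum_(u <- Z) H u * m A u.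
Proof.
move=> mA; rewrite (@eq_Rintegral _ _ _ _ _
  (fun x => \sum_(u <- Z) H u * \1_(p @^-1` [set u]) x)); last first.
  by move=> x _; exact: finite_rangeE.
have mp u : measurable (p @^-1` [set u]) by case: pp.
have bi u := bounded_measurable_indic R (mp u).
rewrite /Rintegral; under eq_integral do rewrite -sumEFin.
rewrite integral_sum//; last first.
  by move=> u; apply: bounded_measurable_integrable => //; exact: bounded_measurableZ.
rewrite -sum_fine; last first.
  move=> u _; apply: integrable_fin_num => //.
  by apply: bounded_measurable_integrable => //; exact: bounded_measurableZ.
apply: eq_bigr => u _; rewrite -/(Rintegral _ _ _) RintegralZl//; last first.
  exact: bounded_measurable_integrable.
by congr (_ * _); rewrite /Rintegral integral_indic// setIC.
Qed.

(** The integral of a simple function can be computed on any finer partition: the fibres of [p] are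
    grouped by the value of [G]. This lets two simple functions be integrated on the same
    partition. *)
Lemma simple_integral_finite_range (S : normedModType R) A (G : U -> S) :
  measurable A -> simple_integral mu A (G \o p) = \sum_(u <- Z) m A u *: G u.
Proof.
move=> mA; have [fp mp] := pp.
have fGp : finite_set (range (G \o p)).
  apply: (sub_finite_set _ (finite_image G fp)) => _ [x _ <-].
  by exists (p x) => //; exists x.
rewrite /simple_integral fsbig_finite//=.
have mE v : fine (mu (A `&` (G \o p) @^-1` [set v])) =
    \sum_(u <- Z) (G u == v)%:R * m A u.
  rewrite -(Rintegral_finite_range (fun u => (G u == v)%:R))//.
  rewrite -[RHS]/(fine _); have mG : measurable ((G \o p) @^-1` [set v]).
    rewrite (_ : _ @^-1` _ = \bigcup_(u in range p `&` [set u | G u = v])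
        p @^-1` [set u]).
      by apply: fin_bigcup_measurable => //; exact: finite_setIl.
    apply/seteqP; split=> [x /= Gx|x [u [_ Gu] /= ->]//].
    by exists (p x) => //; split=> //; exists x.
  rewrite setIC -integral_indic//; congr fine; apply: eq_integral => x _.
  rewrite indicE; congr (_%:R%:E); congr nat_of_bool.
  by apply/idP/eqP => [/set_mem//|Gx]; exact/mem_set.
under eq_bigr do rewrite mE scaler_suml.
rewrite exchange_big/=; apply: eq_big_seq => u uZ.
have GuV : G u \in fset_set (range (G \o p)).
  move: uZ; rewrite !in_fset_set// !inE => -[x _ <-].
  by exists x.
rewrite (bigD1_seq (G u)) ?fset_uniq//= eqxx mul1r big1 ?addr0// => v.
by rewrite eq_sym => /negbTE ->; rewrite mul0r scale0r.
Qed.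

End finite_range.

Section bochner_theory.
Local Open Scope ereal_scope.
Context d (T : measurableType d) (R : realType) (S : completeNormedModType R).
Variable mu : {finite_measure set T -> \bar R}.
Implicit Types (A : set T) (f s t : T -> S).

Lemma simple_integralB_norm A s t : measurable A -> simple_function s ->
  simple_function t ->
  `|simple_integral mu A s - simple_integral mu A t|%:E <=
  \int[mu]_(x in A) `|s x - t x|%:E.
Proof.
move=> mA ss st; have pst := measurable_partition_pair ss st.
pose p x := (s x, t x).
rewrite (simple_integral_finite_range mu pst fst mA).
rewrite (simple_integral_finite_range mu pst snd mA) -sumrB.
apply: le_trans (_ : (\int[mu]_(x in A) `|s x - t x|)%:E <= _); last first.
  rewrite /Rintegral fineK//; apply: integrable_fin_num => //.
  apply: (@bounded_measurable_integrable _ _ _ mu (fun x => `|s x - t x|%R) A) => //.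
  exact: (bounded_measurable_finite_range pst (fun u => `|u.1 - u.2|%R)).
rewrite (Rintegral_finite_range mu pst (fun u => `|u.1 - u.2|%R))// lee_fin.
apply: le_trans (ler_norm_sum _ _ _) _; apply: ler_sum => u _.
by rewrite -scalerBr normrZ ger0_norm ?fine_ge0// mulrC.
Qed.

Lemma simple_integral_dual A s (l : dual S) : measurable A ->
  simple_function s ->
  l (simple_integral mu A s) = (\int[mu]_(x in A) l (s x))%R.
Proof.
move=> mA ss; rewrite (simple_integral_finite_range mu ss id mA) linear_sum/=.
rewrite (Rintegral_finite_range mu ss (fun v => l v))//.
by apply: eq_bigr => v _; rewrite linearZ/= mulrC.
Qed.

(** The triangle inequality under the integral needs additivity, hence measurability of the
    distances from [f] to simple functions. Strong measurability gives it only off a null set [N],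
    so the argument takes place on [A] minus [N]. *)
Lemma simple_functionB_le A f s t : strongly_measurable mu f ->
  measurable A -> simple_function s -> simple_function t ->
  \int[mu]_(x in A) `|s x - t x|%:E <=
  \int[mu]_x `|f x - s x|%:E + \int[mu]_x `|f x - t x|%:E.
Proof.
move=> [a [sa [N [mN N0 aN]]]] mA ss st.
pose D := A `\` N; have mD : measurable D by exact: measurableD.
have mB (u : T -> S) n : simple_function u ->
    measurable_fun D (fun x => `|a n x - u x|%R).
  move=> su; apply: measurable_funTS.
  have pau := measurable_partition_pair (sa n) su.
  by case: (bounded_measurable_finite_range pau (fun u => `|u.1 - u.2|%R)).
have mf (u : T -> S) : simple_function u ->
    measurable_fun D (fun x => `|f x - u x|%R).
  move=> su; apply: (@measurable_fun_cvg _ _ _ _ (fun n x => `|a n x - u x|%R)).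
    by move=> n; exact: mB.
  move=> x [_ Nx]; apply: cvg_norm; apply: cvgB; last exact: cvg_cst.
  by apply: contrapT => ax; apply: Nx; exact: aN.
have mst : measurable_fun A (fun x => `|s x - t x|%:E).
  apply/measurable_EFinP/measurable_funTS.
  have pst := measurable_partition_pair ss st.
  by case: (bounded_measurable_finite_range pst (fun u => `|u.1 - u.2|%R)).
rewrite (ge0_negligible_integral mN mA mst _ N0)// -/D.
apply: (@le_trans _ _ (\int[mu]_(x in D) (`|f x - s x|%:E + `|f x - t x|%:E))).
  apply: ge0_le_integral => //.
  - apply: measurable_funS mst => //; exact: subDsetl.
  - by apply: emeasurable_funD; apply/measurable_EFinP; exact: mf.
  - move=> x _; rewrite -EFinD lee_fin.
    by rewrite (le_trans (ler_distD (f x) _ _))// [X in (X + _)%R]distrC.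
rewrite ge0_integralD//; last 2 first.
- by apply/measurable_EFinP; exact: mf.
- by apply/measurable_EFinP; exact: mf.
by apply: leeD; apply: ge0_subset_le_integral => // x _; rewrite lee_fin.
Qed.

(** The integrals of the approximating simple functions form a Cauchy sequence, because two of them
    differ by at most the sum of their L1 distances to [f]; completeness gives the limit. *)
Lemma bochner_integral_exists A f : bochner_integrable mu f -> measurable A ->
  exists v, is_bochner_integral mu A f v.
Proof.
move=> [sf [s [ss s0]]] mA; pose y n := simple_integral mu A (s n).
have ly n : 0 <= \int[mu]_x `|f x - s n x|%:E by exact: integral_ge0.
have cy : cvgn y.
  apply: cauchy_cvg; apply/cauchy_ballP => e e0.
  have [N _ eN] : \forall n \near \oo,
      \int[mu]_x `|f x - s n x|%:E < (e / 2)%:E.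
    apply: (s0 [set r | r < (e / 2)%:E]); apply: open_nbhs_nbhs; split.
      exact: open_ereal_lt_ereal.
    by rewrite /= lte_fin divr_gt0.
  pose W := [set y n | n in [set n | (N <= n)%N]].
  exists (W, W); first by split; exists N => // n Nn; exists n.
  move=> [_ _] [/= [m Nm <-] [n Nn <-]]; rewrite -ball_normE /= -lte_fin.
  apply: le_lt_trans (simple_integralB_norm mA (ss m) (ss n)) _.
  apply: le_lt_trans (simple_functionB_le sf mA (ss m) (ss n)) _.
  by rewrite (splitr e) EFinD; apply: lteD; exact: eN.
exists (limn y); exists s; split=> //.
apply: (@squeeze_cvge _ _ _ _ (fun=> 0) _ (fun n => \int[mu]_x `|f x - s n x|%:E)).
- apply: nearW => n; rewrite integral_ge0//=.
  by apply: ge0_subset_le_integral => // x _; rewrite lee_fin.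
- exact: cvg_cst.
- exact: s0.
Qed.

(** The value selected by [get] is a limit of simple integrals, with which [l] commutes. Their
    images also tend to the integral of [l] along [f], since [l] is Lipschitz and the approximation
    holds in L1. *)
Lemma bochner_integral_dual A f (l : dual S) : bochner_integrable mu f ->
  measurable A -> bounded_measurable (fun x => l (f x)) ->
  l (bochner_integral mu A f) = (\int[mu]_(x in A) l (f x))%R.
Proof.
move=> bf mA blf; have := getPex (bochner_integral_exists bf mA).
rewrite -/(bochner_integral mu A f); set v := bochner_integral _ _ _.
move=> [s [ss s0 sv]].
(* The added 1 makes the Lipschitz constant positive, so that it can be divided by even if [l] is
   0. *)
pose C := (dual_norm l + 1)%R; have C0 : (0 < C)%R.
  by rewrite ltr_wpDl// dual_norm_ge0.
have ls n : bounded_measurable (fun x => l (s n x)).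
  exact: (bounded_measurable_finite_range (ss n) l).
have lv : l (simple_integral mu A (s n)) @[n --> \oo] --> (l v : R).
  by apply: cvg_comp sv _; exact: dual_continuous.
have dist n : (`|l (simple_integral mu A (s n)) - \int[mu]_(x in A) l (f x)|%R
    / C)%:E <= \int[mu]_(x in A) `|f x - s n x|%:E.
  rewrite simple_integral_dual// -RintegralB//;
    [|exact: bounded_measurable_integrable..].
  have bD := bounded_measurableB (ls n) blf.
  have bnD := bounded_measurable_norm bD.
  have bnDC := bounded_measurableZ C^-1 bnD.
  apply: (@le_trans _ _ (\int[mu]_(x in A) (C^-1 * `|l (s n x) - l (f x)|)%:E)).
    apply: (@le_trans _ _ (\int[mu]_(x in A) (C^-1 * `|l (s n x) - l (f x)|))%R%:E).
      rewrite lee_fin RintegralZl//; last exact: bounded_measurable_integrable.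
      rewrite mulrC ler_pM2l ?invr_gt0//; apply: le_normr_Rintegral => //.
      exact: bounded_measurable_integrable.
    rewrite /Rintegral fineK//; apply: integrable_fin_num => //.
    exact: bounded_measurable_integrable.
  apply: ge0_subset_le_integral => // x Ax; rewrite lee_fin.
    by rewrite mulr_ge0// invr_ge0 ltW.
  rewrite ler_pdivrMl// distrC -[X in `|X|%R](linearB l).
  apply: le_trans (dual_pairing_le _ _) _; rewrite ler_wpM2r//.
  by rewrite lerDl.
pose c := (\int[mu]_(x in A) l (f x))%R.
pose D n := (`|l (simple_integral mu A (s n)) - c| / C)%R.
have D0 : (D n)%:E @[n --> \oo] --> (0 : \bar R).
  apply: (@squeeze_cvge _ _ _ _ (fun=> 0) _
    (fun n => \int[mu]_(x in A) `|f x - s n x|%:E)) => //; last exact: cvg_cst.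
  by apply: nearW => n; rewrite dist andbT lee_fin divr_ge0// ltW.
have Dv : D n @[n --> \oo] --> (`|l v - c| / C)%R.
  by apply: cvgMr_tmp; apply: cvg_norm; apply: cvgB => //; exact: cvg_cst.
have : (`|l v - c| / C = 0)%R.
  by apply: (cvg_unique _ Dv (fine_cvg D0)).
move/eqP; rewrite mulf_eq0 invr_eq0 (gt_eqF C0) orbF normr_eq0 subr_eq0.
by move/eqP.
Qed.

End bochner_theory.

(** * Borel measures on metric spaces *)

Section image_measure.
Context d1 d2 (T1 : measurableType d1) (T2 : measurableType d2) (R : realType).
Variables (m : {finite_measure set T1 -> \bar R}) (D : set T1) (phi : T1 -> T2).
Hypotheses (mD : measurable D) (mphi : measurable_fun setT phi).
Local Open Scope ereal_scope.

Let p (A : set T2) : \bar R := m (phi @^-1` A `&` D).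

Let mpre A : measurable A -> measurable (phi @^-1` A).
Proof. by move=> mA; rewrite -[X in measurable X]setTI; exact: mphi. Qed.

Let p0 : p set0 = 0. Proof. by rewrite /p preimage_set0 set0I measure0. Qed.

Let p_ge0 A : 0 <= p A. Proof. exact: measure_ge0. Qed.

Let p_sigma_additive : semi_sigma_additive p.
Proof.
move=> F mF tF mUF; rewrite /p preimage_bigcup setI_bigcupl.
apply: measure_semi_sigma_additive.
- by move=> n; apply: measurableI => //; exact: mpre.
- apply/trivIsetP => i j _ _ ij; apply/seteqP; split=> // x [[Fix _] [Fjx _]].
  have /trivIsetP/(_ _ _ Logic.I Logic.I ij) FF := tF.
  by have : (F i `&` F j) (phi x) by []; rewrite FF.
- by rewrite -setI_bigcupl -preimage_bigcup; apply: measurableI => //; exact: mpre.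
Qed.

#[local] HB.instance Definition _ := isMeasure.Build _ _ _ p p0 p_ge0 p_sigma_additive.

Let p_fin : fin_num_fun p.
Proof. by move=> A mA; apply: fin_num_measure; apply: measurableI => //; exact: mpre. Qed.

#[local] HB.instance Definition _ := Measure_isFinite.Build _ _ _ p p_fin.

(** One construction for three uses: the first marginal of a plan, its slices over the points of
    [Y], and the plan carried by the graph of a map. *)
Lemma image_measure_exists : exists q : {finite_measure set T2 -> \bar R},
  (forall A, q A = m (phi @^-1` A `&` D)) /\
  forall f : T2 -> \bar R, measurable_fun setT f -> (forall y, 0 <= f y) ->
    \int[q]_y f y = \int[m]_(x in D) f (phi x).
Proof.
exists p; split=> // f mf f0.
have -> : \int[p]_y f y = \int[mrestr m mD]_x f (phi x).
  exact: (@ge0_integral_pushforward _ _ _ _ _ _ mphi (mrestr m mD)).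
have mfphi : measurable_fun setT (f \o phi) by exact: measurableT_comp.
rewrite (@ge0_negligible_integral _ _ _ (mrestr m mD) setT (~` D))//=.
- rewrite setTD setCK; apply: eq_measure_integral => A mA AD.
  by rewrite /= /mrestr setIidl.
- exact: measurableC.
- by rewrite /mrestr setICl measure0.
Qed.

End image_measure.

Section bounded_image.
Context d1 d2 (T1 : measurableType d1) (T2 : measurableType d2) (R : realType).
Variables (m : {finite_measure set T1 -> \bar R}) (q : {finite_measure set T2 -> \bar R}).
Variables (D : set T1) (phi : T1 -> T2).
Hypotheses (mD : measurable D) (mphi : measurable_fun setT phi).
Hypothesis qE : forall f : T2 -> \bar R, measurable_fun setT f ->
  (forall y, 0 <= f y)%E -> (\int[q]_y f y = \int[m]_(x in D) f (phi x))%E.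

Lemma bounded_measurable_comp (u : T2 -> R) : bounded_measurable u ->
  bounded_measurable (u \o phi).
Proof.
move=> [mu [r ur]]; split; first exact: measurableT_comp.
by exists r => x; exact: ur.
Qed.

Lemma image_measure_Rintegral (u : T2 -> R) : bounded_measurable u ->
  \int[q]_y u y = \int[m]_(x in D) u (phi x).
Proof.
move=> bu; have [mu [r ur]] := bu.
have ge0E v : bounded_measurable v -> (forall y, 0 <= v y) ->
    \int[q]_y v y = \int[m]_(x in D) v (phi x).
  move=> [mv _] v0; congr fine; rewrite (qE (f := fun y => (v y)%:E))//.
  exact/measurable_EFinP.
have br := bounded_measurable_cst T2 r.
have r0 : 0 <= r by rewrite (le_trans _ (ur point)).
have bur := bounded_measurableD bu br.
have intE d (T : measurableType d) (n : {finite_measure set T -> \bar R}) A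
    (v : T -> R) : measurable A -> bounded_measurable v ->
    \int[n]_(x in A) v x = \int[n]_(x in A) (v x + r) - \int[n]_(x in A) r.
  move=> mA bv; rewrite -RintegralB//.
  - by apply: eq_Rintegral => x _; rewrite addrK.
  - apply: bounded_measurable_integrable => //.
    exact/bounded_measurableD/bounded_measurable_cst.
  - exact/bounded_measurable_integrable/bounded_measurable_cst.
rewrite intE// (intE _ _ m D (u \o phi))//; last exact: bounded_measurable_comp.
rewrite ge0E// ?(ge0E _ br)//.
by move=> x; rewrite -lerBlDr sub0r; have := ur x; rewrite ler_norml => /andP[].
Qed.

End bounded_image.

Section shift_integral.
Context d (T : measurableType d) (R : realType).
Variable m : {finite_measure set T -> \bar R}.

(** The integral of [f] may be [+oo]. The identity (f - r) + f^- = f^+ - r has nonnegative terms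
    only, as r <= 0; integrate it and cancel the integral of f^-, finite because f^- <= -r. This
    reduces costs bounded below to nonnegative ones. *)
Lemma integral_shift (f : T -> R) (r : R) : measurable_fun setT f -> r <= 0 ->
  (forall x, r <= f x) ->
  (\int[m]_x (f x)%:E = \int[m]_x (f x - r)%:E + r%:E * m setT)%E.
Proof.
move=> mf r0 rf.
have mfE : measurable_fun setT (EFin \o f) by exact/measurable_EFinP.
have mfr : measurable_fun setT (fun x => (f x - r)%:E).
  by apply/measurable_EFinP; exact: measurable_funB.
have fr0 x : (0 <= (f x - r)%:E)%E by rewrite lee_fin subr_ge0.
have mr : (m setT) \is a fin_num by exact: fin_num_measure.
have nfin : (\int[m]_x ((EFin \o f)^\- x) \is a fin_num)%E.
  rewrite ge0_fin_numE ?integral_ge0//.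
  apply: (@le_lt_trans _ _ (\int[m]_x (- r)%:E)%E).
    apply: ge0_le_integral => //; first exact: measurable_funeneg.
    move=> x _; rewrite funenegE /= -EFin_max lee_fin ge_max lerN2 rf/=.
    by rewrite oppr_ge0.
  by rewrite integral_cst// -ge0_fin_numE ?mule_ge0 ?lee_fin ?oppr_ge0// fin_numM.
have E : (\int[m]_x (f x - r)%:E + \int[m]_x ((EFin \o f)^\- x) =
    \int[m]_x ((EFin \o f)^\+ x) + \int[m]_x (- r)%:E)%E.
  have mp := measurable_funepos mfE; have mn := measurable_funeneg mfE.
  have r0' (x : T) : (0 <= (- r)%:E)%E by rewrite lee_fin oppr_ge0.
  rewrite -ge0_integralD// -ge0_integralD//; last by move=> x _; exact: r0'.
  apply: eq_integral => x _; rewrite funeposE funenegE /= -!EFin_max -!EFinD.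
  congr EFin; move: (f x) => y.
  have -> : Num.max (- y) 0 = Num.max y 0 - y.
    have [y0|/ltW y0] := leP 0 y; first by rewrite max_r ?oppr_le0// subrr.
    by rewrite max_l ?oppr_ge0// sub0r.
  by rewrite addrC addrA subrK.
have fE : (\int[m]_x (f x)%:E = \int[m]_x ((EFin \o f)^\+ x) -
    \int[m]_x ((EFin \o f)^\- x))%E by exact: integralE.
have cE : (\int[m]_x (- r)%:E = (- r * fine (m setT))%:E)%E.
  by rewrite integral_cst// EFinM fineK.
rewrite fE; move: E; rewrite cE -(fineK nfin).
rewrite -[in X in _ -> X](fineK mr) -EFinM.
move: (\int[m]_x (f x - r)%:E)%E (\int[m]_x ((EFin \o f)^\+ x))%E => a b.
case: a => [a| |]; case: b => [b| |]//=.
rewrite -!EFinD => -[E]; congr EFin.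
by rewrite -[b](addrK (- r * fine (m setT))) -E mulNr opprK addrAC addrK.
Qed.

End shift_integral.

Section borel_measurability.
Context {R : realType} {X : ptopologicalType}.

Lemma open_borel (A : set X) : open A -> measurable (A : set (borel X)).
Proof. by move=> oA; exact: sub_sigma_algebra. Qed.

Lemma open_rays_measurable (u : X -> R) :
  (forall a, open [set x | a < u x]) -> measurable_fun setT (u : borel X -> R).
Proof.
move=> ou; apply: (measurability _ (RGenOInfty.measurableE R)).
move=> _ [_ [a ->] <-]; rewrite setTI; apply: open_borel.
rewrite (_ : _ @^-1` _ = [set x | a < u x]); first exact: ou.
by apply/seteqP; split=> x /=; rewrite in_itv/= andbT.
Qed.

Lemma continuous_borel (u : X -> R) : continuous u ->
  measurable_fun setT (u : borel X -> R).
Proof.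
move=> /continuousP cu; apply: open_rays_measurable => a.
exact/(cu [set y | a < y])/open_gt.
Qed.

Lemma continuous_bounded_measurable (u : X -> R) : compact [set: X] ->
  continuous u -> bounded_measurable (u : borel X -> R).
Proof.
move=> cX cu; split; first exact: continuous_borel.
have : compact (u @` setT).
  by apply: continuous_compact => //; exact: continuous_subspaceT.
move=> /compact_bounded[M [_ Mu]]; exists (M + 1) => x.
by apply: Mu; [rewrite ltrDl|exists x].
Qed.

Lemma continuous_borel_map (Y : ptopologicalType) (f : X -> Y) : continuous f ->
  measurable_fun setT (f : borel X -> borel Y).
Proof.
move=> /continuousP cf.
apply: (@measurability _ _ (borel X) (borel Y) setT f (@open Y)) => //.
by move=> _ [A oA <-]; rewrite setTI; apply: open_borel; exact: cf.
Qed.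

End borel_measurability.

Section measures_on_metric_spaces.
Context {R : realType} {X : pmetricType R}.

Lemma edist_inf_fin (C : set X) (a x : X) : C a -> @edist_inf R X C x \is a fin_num.
Proof.
move=> Ca; rewrite ge0_fin_numE ?edist_inf_ge0//; apply: le_lt_trans.
  by apply: ereal_inf_lbound; exists a.
rewrite -ge0_fin_numE ?edist_ge0//; apply/edist_finP => /=.
exists (mdist x a + 1); first by rewrite ltr_wpDl// mdist_ge0.
by rewrite ballEmdist/= ltrDl.
Qed.

Lemma edist_inf_gt0 (C : set X) (x : X) : closed C -> ~ C x ->
  (0 < @edist_inf R X C x)%E.
Proof.
move=> cC nCx; have : nbhs x (~` C).
  by apply: open_nbhs_nbhs; split=> //; exact: closed_openC.
move=> /nbhs_ballP[e /= e0 eC].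
apply: (@lt_le_trans _ _ e%:E); first by rewrite lte_fin.
apply: le_ereal_inf_tmp => _ [y Cy <-]; rewrite leNgt; apply/negP => xy.
by have := eC y (@edist_lt_ball R X e (x, y) xy).
Qed.

(* The indicator of an open set U is the increasing limit of the continuous
   functions min(1, n dist(x, ~U)). *)
Lemma measure_eq_continuous (m1 m2 : {finite_measure set (borel X) -> \bar R}) :
  (forall u : X -> R, continuous u -> (forall x, 0 <= u x <= 1) ->
    (\int[m1]_x (u x)%:E = \int[m2]_x (u x)%:E)%E) ->
  forall A : set (borel X), measurable A -> m1 A = m2 A.
Proof.
move=> m12; have one (m : {finite_measure set (borel X) -> \bar R}) :
    (\int[m]_x 1%:E = m setT)%E by rewrite integral_cst// mul1e.
have m12T : m1 setT = m2 setT.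
  by rewrite -!one; apply: m12 => [x|x]; [exact: cvg_cst|rewrite ler01 lexx].
have m12o U : open U -> m1 U = m2 U.
  (* The distance to an empty complement is infinite, so the whole space is treated apart. *)
  move=> oU; have [CU|/set0P[a Ca]] := eqVneq (~` U) set0.
    by rewrite -[U]setCK CU setC0.
  pose D x := fine (@edist_inf R X (~` U) x).
  have D0 x : 0 <= D x by rewrite fine_ge0// edist_inf_ge0.
  have cD : continuous D.
    move=> x; apply: fine_cvg; rewrite fineK; last exact: edist_inf_fin Ca.
    exact: edist_inf_continuous.
  pose u n x : R := Num.min 1 (n%:R * D x).
  have cu n : continuous (u n).
    move=> x; apply: (@continuous_min _ _ (fun=> 1) (fun y => n%:R * D y)).
      exact: cvg_cst.
    by apply: cvgMl_tmp; exact: cD.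
  have u01 n x : 0 <= u n x <= 1.
    by rewrite /u ge_min lexx le_min ler01 mulr_ge0.
  have ucvg x : (u n x)%:E @[n --> \oo] --> (\1_U x)%:E.
    apply: cvg_near_cst; have [Ux|nUx] := pselect (U x); last first.
      apply: nearW => n; rewrite /u /D edist_inf0//= mulr0 min_r//.
      by rewrite indicE memNset.
    have Dx : 0 < D x.
      rewrite -lte_fin fineK; last exact: edist_inf_fin Ca.
      by apply: edist_inf_gt0; [exact: open_closedC|exact].
    near=> n; rewrite indicE mem_set// /u min_l// -ler_pdivrMr// mul1r.
    rewrite (le_trans (ltW (truncnS_gt _)))// ler_nat.
    by near: n; exact: nbhs_infty_ge.
  have cvgm (m : {finite_measure set (borel X) -> \bar R}) :
      (\int[m]_x (u n x)%:E @[n --> \oo] --> m U)%E.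
    have mU := open_borel oU.
    rewrite (_ : m U = \int[m]_x limn (fun n => (u n x)%:E))%E; last first.
      rewrite -[U in LHS]setIT -integral_indic//; apply: eq_integral => x _.
      by apply/esym/cvg_lim => //; exact: ucvg.
    apply: (@cvg_monotone_convergence _ _ _ m _ measurableT (fun n x => (u n x)%:E)).
    - by move=> n; apply/measurable_EFinP; exact: continuous_borel.
    - by move=> n x _; rewrite lee_fin; have /andP[] := u01 n x.
    - move=> x _ k n kn; rewrite lee_fin /u; apply: le_min2 => //.
      by rewrite ler_wpM2r// ler_nat.
  have c1 := cvgm m1; have c2 := cvgm m2.
  have E : (fun n => \int[m1]_x (u n x)%:E)%E = (fun n => \int[m2]_x (u n x)%:E)%E.
    by apply/funext => n; exact: m12.
  by rewrite E in c1; exact: (cvg_unique (@ereal_hausdorff R) c1 c2).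
move=> A mA; apply: (@measure_unique _ R (borel X) (@open X) (fun=> setT)
  _ _ _ _ m1 m2) => //.
- by move=> B C; exact: openI.
- by move=> _; exact: openT.
- by rewrite bigcup_const//; exists 0.
- by move=> _; rewrite ltey_eq fin_num_measure.
Unshelve. all: by end_near. Qed.

End measures_on_metric_spaces.

(** * Pairing a norm continuous map with a weakly continuous one *)

Section weak_continuity.
Context {R : realType} {S : normedModType R} (F : set (dual S)).

Lemma weak_continuous_dual (X : topologicalType) (h : X -> weak_space F)
    (f : dual S) : continuous h -> F f -> continuous (fun x => f (h x) : R).
Proof.
move=> ch Ff x; pose fF : {f : dual S | F f} := exist _ f Ff.
have hx : h @ x --> (h x : initial_topology (sval fF : S -> R^o)).
  exact: (@cvg_sup _ _ (fun f : {f : dual S | F f} =>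
    Topological.class (initial_topology (sval f : S -> R^o)))
    (h @ x) (h x) _).1 (ch x) fF.
apply: (cvg_comp _ _ hx); exact: (@initial_continuous _ _ (sval fF : S -> R^o)).
Qed.

(** Near [x], the term [(psi y - psi x) (h y)] is small by norm continuity of [psi] and boundedness
    of [h], and [psi x (h y)] converges by weak continuity, because [psi x] lies in [F]. *)
Lemma pairing_continuous (X : topologicalType) (h : X -> weak_space F)
    (psi : X -> dual S) (M : R) : continuous h -> (forall x, `|h x : S| <= M) ->
  continuous psi -> (forall x, F (psi x)) ->
  continuous (fun x => psi x (h x) : R).
Proof.
move=> ch hM cpsi Fpsi x.
have c1 := weak_continuous_dual ch (Fpsi x).
suff : ((psi y - psi x) (h y) + psi x (h y) : R) @[y --> x] -->
    (0 + psi x (h x) : R).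
  rewrite add0r (_ : (fun y => _) = fun y => psi y (h y) : R)//.
  by apply/funext => y; rewrite /= subrK.
apply: cvgD; last exact: c1.
apply/cvgr0Pnorm_le => e e0.
have M1 : 0 < M + 1 by rewrite ltr_wpDl// (le_trans _ (hM x)).
have : \forall y \near x, `|psi x - psi y| <= e / (M + 1).
  by move: (cpsi x) => /cvgrPdist_le; apply; rewrite divr_gt0.
apply: filterS => y; rewrite distrC => xy.
apply: le_trans (dual_pairing_le _ _) _.
apply: (@le_trans _ _ (e / (M + 1) * M)).
  by apply: ler_pM => //; exact: dual_norm_ge0.
by rewrite mulrAC ler_pdivrMr// ler_pM2l// lerDl.
Qed.

End weak_continuity.

(** * Finite partitions and finite metric spaces *)

Section finite_partition.
Context d (T : measurableType d) (R : realType) (I : finType) (p : T -> I).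
Variable m : {finite_measure set T -> \bar R}.
Hypothesis mp : forall i, measurable (p @^-1` [set i]).

Let sum_indic (x : T) : \sum_i \1_(p @^-1` [set i]) x = 1 :> R.
Proof.
rewrite (bigD1 (p x))//= indicE mem_set//= big1 ?addr0// => i ix.
by rewrite indicE memNset//= => xi; rewrite xi eqxx in ix.
Qed.

Lemma partition_Rintegral (u : T -> R) : bounded_measurable u ->
  \int[m]_x u x = \sum_i \int[m]_(x in p @^-1` [set i]) u x.
Proof.
move=> bu; under [RHS]eq_bigr do rewrite -Rintegral_indicM /Rintegral.
have bi i : bounded_measurable (fun x => \1_(p @^-1` [set i]) x * u x).
  exact/bounded_measurableM/bu/bounded_measurable_indic.
rewrite sum_fine; last first.
  by move=> i _; apply: integrable_fin_num => //; exact: bounded_measurable_integrable.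
rewrite -integral_sum//; last by move=> i; exact: bounded_measurable_integrable.
congr fine; apply: eq_integral => x _.
by rewrite sumEFin -mulr_suml sum_indic mul1r.
Qed.

Lemma partition_integral (f : T -> \bar R) : measurable_fun setT f ->
  (forall x, 0 <= f x)%E ->
  (\int[m]_x f x = \sum_i \int[m]_(x in p @^-1` [set i]) f x)%E.
Proof.
move=> mf f0.
have mfi i : measurable_fun setT (f \_ (p @^-1` [set i])).
  by apply/(measurable_restrictT _ _).1 => //; exact: measurable_funTS.
under [RHS]eq_bigr do rewrite integral_mkcond.
rewrite -ge0_integral_sum//; last by move=> i x _; exact: erestrict_ge0.
apply: eq_integral => x _; rewrite (bigD1 (p x))//= patchE mem_set// big1 ?adde0//.
by move=> i ix; rewrite patchE memNset//= => xi; rewrite xi eqxx in ix.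
Qed.

Lemma partition_measure (A : set T) : measurable A ->
  (m A = \sum_i m (A `&` p @^-1` [set i]))%E.
Proof.
move=> mA; rewrite -[A in LHS]setIT -integral_indic//.
rewrite partition_integral//; last by apply/measurable_EFinP; exact: measurable_indic.
by apply: eq_bigr => i _; rewrite integral_indic.
Qed.

End finite_partition.

Section finite_metric_space.
Context {R : realType} {Y : pmetricType R}.
Hypothesis finiteY : finite_set [set: Y].

Lemma finite_metric_open (A : set Y) : open A.
Proof.
have /accessible_finite_set_closed fc : accessible_space Y.
  exact/hausdorff_accessible/metric_hausdorff.
rewrite -[A]setCK; apply: closed_openC; apply: fc.
exact: sub_finite_set finiteY.
Qed.

Lemma finite_metric_continuous (Z : topologicalType) (f : Y -> Z) : continuous f.
Proof. by apply/continuousP => A _; exact: finite_metric_open. Qed.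

Lemma finite_metric_measurable (A : set (borel Y)) : measurable A.
Proof. by apply: open_borel; exact: finite_metric_open. Qed.

Lemma finite_metric_bounded_measurable (u : Y -> R) :
  bounded_measurable (u : borel Y -> R).
Proof.
apply: continuous_bounded_measurable; first exact: finite_compact.
exact: finite_metric_continuous.
Qed.

End finite_metric_space.

(** Indexes the points of the target by a [finType], over which plans can be decomposed into finite
    sums. *)
Lemma finite_set_enum (Y : choiceType) : finite_set [set: Y] ->
  exists (I : finType) (e : I -> Y) (r : Y -> I), cancel r e /\ cancel e r.
Proof.
move=> /finite_seqP[s sY]; have ys y : y \in s by have : [set: Y] y by []; rewrite sY.
exists (seq_sub s), (@ssval _ s), (fun y => SeqSub (ys y)); split=> // i.
exact: val_inj.
Qed.

(** * Plans and maps with a finite target *)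

HB.instance Definition _ (X Y : ptopologicalType) := Pointed.on (X * Y)%type.

Section transport_theory.
Context {R : realType} {X Y : pmetricType R} {S : completeNormedModType R}.
Variables (F : set (dual S)) (mu : vmeasure X S) (nu : vmeasure Y S).
Hypothesis compactX : compact [set: X].
Hypothesis finiteY : finite_set [set: Y].
Hypothesis subspaceF : linear_subspace F.
Hypothesis separatingF : separates_points F.
Hypothesis bounded_density : bounded_fun (density mu).
Hypothesis continuous_density : continuous (density mu : X -> weak_space F).
Hypothesis normalized_density : exists2 f, cont_into X F f &
  forall x, f x (density mu x) = 1.
Variables (I : finType) (e : I -> Y) (r : Y -> I).
Hypotheses (rK : cancel r e) (eK : cancel e r).

Local Notation lam := (Defs.variation mu).
Local Notation eta := (density mu).
Local Notation atom i := (vmeasure_val nu [set e i]).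
Local Notation L := {f : dual S | F f}.

Let w (l : L) (x : borel X) : R := sval l (eta x).
Let b (i : I) (l : L) : R := sval l (atom i).

Let F0 : F 0. Proof. by case: subspaceF. Qed.

Let FZ (k : R) f : F f -> F (k *: f).
Proof.
move=> Ff; have [_ /(_ k f 0 Ff F0)] := subspaceF.
by rewrite addr0.
Qed.

Let eta_le : exists M, forall x, `|eta x| <= M.
Proof.
have [M [_ Me]] := bounded_density.
by exists (M + 1) => x; apply: Me => //; rewrite ltrDl.
Qed.

Let compactXY : compact [set: X * Y].
Proof. by rewrite -setXTT; apply: compact_setX => //; exact: finite_compact. Qed.

Lemma dual_density_bounded_measurable (l : dual S) : F l ->
  bounded_measurable (fun x : borel X => l (eta x)).
Proof.
move=> Fl; apply: (continuous_bounded_measurable (u := fun x : X => l (eta x))) => //.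
exact: weak_continuous_dual.
Qed.

Lemma pairing_bounded_measurable psi : cont_into X F psi ->
  bounded_measurable (fun x : borel X => psi x (eta x)).
Proof.
move=> [cpsi Fpsi]; have [M etaM] := eta_le.
apply: (continuous_bounded_measurable (u := fun x : X => psi x (eta x))) => //.
exact: pairing_continuous etaM cpsi Fpsi.
Qed.

Lemma plan_pairing_bounded_measurable psi phi : cont_into X F psi ->
  cont_into Y F phi -> bounded_measurable (fun z : borel (X * Y)%type =>
    (psi (z : X * Y).1 + phi (z : X * Y).2) (eta (z : X * Y).1)).
Proof.
move=> [cpsi Fpsi] [cphi Fphi]; have [M etaM] := eta_le.
apply: (continuous_bounded_measurable
  (u := fun z : X * Y => (psi z.1 + phi z.2) (eta z.1))) => //.
apply: (pairing_continuous (h := eta \o fst : X * Y -> weak_space F)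
  (psi := fun z : X * Y => psi z.1 + phi z.2) (M := M)).
- move=> z; apply: (@continuous_comp _ _ _ fst (eta : X -> weak_space F)).
    exact: cvg_fst.
  exact: continuous_density.
- by move=> z; exact: etaM.
- move=> z; apply: cvgD.
    apply: (@continuous_comp _ _ _ fst psi); first exact: cvg_fst.
    exact: cpsi.
  apply: (@continuous_comp _ _ _ snd phi); first exact: cvg_snd.
  exact: cphi.
- move=> z; have [_ /(_ 1 _ _ (Fpsi z.1) (Fphi z.2))] := subspaceF.
  by rewrite scale1r.
Qed.

Lemma vmeasure_dual (A : set (borel X)) l : F l -> measurable A ->
  l (vmeasure_val mu A) = \int[lam]_(x in A) l (eta x).
Proof.
move=> Fl mA; apply: bochner_integral_dual => //.
  exact: density_integrable.
exact: dual_density_bounded_measurable.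
Qed.

Lemma vmeasure_dual_finite (B : set Y) (l : dual S) :
  l (vmeasure_val nu B) = \int[Defs.variation nu]_(y in B) l (density nu y).
Proof.
apply: bochner_integral_dual.
- exact: density_integrable.
- exact: finite_metric_measurable.
- exact: (finite_metric_bounded_measurable finiteY (fun y => l (density nu y))).
Qed.

Let mr i : measurable ((r : borel Y -> I) @^-1` [set i]).
Proof. exact: finite_metric_measurable. Qed.

Let rE i : r @^-1` [set i] = [set e i].
Proof. by apply/seteqP; split=> y /= => [<-|->]. Qed.

Lemma pairing_integral_finite (phi : Y -> dual S) :
  pairing_integral phi nu = (\sum_i phi (e i) (atom i))%:E.
Proof.
have bphi := finite_metric_bounded_measurable finiteY (fun y => phi y (density nu y)).
rewrite /pairing_integral -[LHS]fineK; last first.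
  by apply: integrable_fin_num => //; exact: bounded_measurable_integrable.
rewrite -[fine _]/(Rintegral _ _ _) (partition_Rintegral _ mr)//; congr EFin.
apply: eq_bigr => i _; rewrite rE vmeasure_dual_finite.
by apply: eq_Rintegral => y /set_mem ->.
Qed.

Lemma pairing_integral_EFin psi : cont_into X F psi ->
  pairing_integral psi mu = (\int[lam]_x psi x (eta x))%:E.
Proof.
move=> cpsi; rewrite /pairing_integral /Rintegral fineK//.
apply: integrable_fin_num => //; apply: bounded_measurable_integrable => //.
exact: pairing_bounded_measurable.
Qed.

Lemma transport_planP (pi : {finite_measure set (borel (X * Y)%type) -> \bar R}) :
  transport_plans F mu nu pi <->
  forall psi phi, cont_into X F psi -> cont_into Y F phi ->
    \int[pi]_z ((psi (z : X * Y).1 + phi (z : X * Y).2) (eta (z : X * Y).1)) =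
    \int[lam]_x psi x (eta x) + \sum_i phi (e i) (atom i).
Proof.
have E psi phi : cont_into X F psi -> cont_into Y F phi ->
    (\int[pi]_z ((psi (z : X * Y).1 + phi (z : X * Y).2) (eta (z : X * Y).1))%:E =
    (\int[pi]_z ((psi (z : X * Y).1 + phi (z : X * Y).2) (eta (z : X * Y).1)))%:E)%E.
  move=> cpsi cphi; rewrite /Rintegral fineK//; apply: integrable_fin_num => //.
  apply: bounded_measurable_integrable => //.
  exact: plan_pairing_bounded_measurable.
split=> piP psi phi cpsi cphi; have := piP _ _ cpsi cphi.
  rewrite E// pairing_integral_EFin// pairing_integral_finite -EFinD.
  by case.
by rewrite E// pairing_integral_EFin// pairing_integral_finite -EFinD => ->.
Qed.

Let mfst : measurable_fun setT (fst : borel (X * Y)%type -> borel X).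
Proof. by apply: continuous_borel_map => z; exact: cvg_fst. Qed.

Let msnd i : measurable ((fun z : borel (X * Y)%type => r (z : X * Y).2) @^-1` [set i]).
Proof.
apply: open_borel; rewrite (_ : _ @^-1` _ = snd @^-1` [set e i]).
  have /continuousP cs : continuous (snd : X * Y -> Y) by move=> z; exact: cvg_snd.
  exact/cs/finite_metric_open.
by rewrite -rE.
Qed.

Lemma cont_into_const f : F f -> cont_into Y F (fun=> f).
Proof. by move=> Ff; split=> // y; exact: cvg_cst. Qed.

(** With [psi] equal to [u *: f] and [phi] equal to 0, both sides of the plan identity become
    integrals of [u]; continuous [u] with values in [0, 1] determine a finite Borel measure. *)
Lemma plan_marginal (pi : {finite_measure set (borel (X * Y)%type) -> \bar R}) :
  transport_plans F mu nu pi ->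
  forall A : set (borel X), measurable A -> pi (fst @^-1` A) = lam A.
Proof.
move=> plan_pi; have [q [qE qint]] := image_measure_exists pi measurableT mfst.
move=> A mA; rewrite -[fst @^-1` A]setIT -qE; move: A mA.
apply: measure_eq_continuous => u cu u01.
have mu' : measurable_fun setT (EFin \o u : borel X -> \bar R).
  by apply/measurable_EFinP; exact: continuous_borel.
rewrite (qint _ mu'); last by move=> x; rewrite lee_fin; have /andP[] := u01 x.
have [f [cf Ff] f1] := normalized_density.
have cuf : cont_into X F (fun x => u x *: f x).
  by split=> x; [apply: cvgZ; [exact: cu|exact: cf]|exact: FZ].
have := plan_pi _ _ cuf (cont_into_const F0).
rewrite /pairing_integral [X in (_ + X)%E](_ : _ = 0%E) ?adde0; last first.
  by apply: integral0_eq.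
rewrite (eq_integral (fun z : borel (X * Y)%type => (u (z : X * Y).1)%:E)); last first.
  by move=> z _; congr EFin; rewrite addr0 -[RHS]mulr1 -(f1 z.1).
move=> ->; apply: eq_integral => x _; congr EFin.
by rewrite -[RHS]mulr1 -(f1 x).
Qed.

(** The component of index [i] is the image under the first projection of the plan restricted to the
    slice over [e i]. *)
Lemma plan_decomposition (pi : {finite_measure set (borel (X * Y)%type) -> \bar R}) :
  transport_plans F mu nu pi ->
  exists pis : I -> {finite_measure set (borel X) -> \bar R},
    decomposition lam w b pis /\
    forall c : X * Y -> R, measurable_fun setT (c : borel (X * Y)%type -> R) ->
      (forall i, measurable_fun setT ((fun x => c (x, e i)) : borel X -> R)) ->
      (forall z, 0 <= c z) ->
      (\sum_i \int[pis i]_x (c (x, e i))%:E = \int[pi]_z (c z)%:E)%E.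
Proof.
move=> plan_pi.
have /choice[pis pisP] i := image_measure_exists pi (msnd i) mfst.
exists pis; split; last first.
  move=> c mc mci c0; rewrite (partition_integral _ msnd)//; last first.
    exact/measurable_EFinP.
  have mciE i : measurable_fun setT (fun x : borel X => (c (x, e i))%:E).
    by apply/measurable_EFinP; exact: mci.
  apply: eq_bigr => i _; rewrite ((pisP i).2 _ (mciE i)); last first.
    by move=> x; rewrite lee_fin.
  by apply: eq_integral => z /set_mem /= <-; rewrite rK -surjective_pairing.
split=> [A mA|i l].
  rewrite -(plan_marginal plan_pi)// (partition_measure _ msnd)//.
    by apply: eq_bigr => i _; rewrite (pisP i).1.
  by rewrite -[X in measurable X]setTI; exact: mfst.
have Fl : F (sval l) by case: l.
rewrite (image_measure_Rintegral (msnd i) mfst (pisP i).2); last first.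
  exact: dual_density_bounded_measurable.
(* The test function equal to [l] at [e i] and to 0 elsewhere is continuous because [Y] is discrete;
   it isolates the slice over [e i]. *)
have cl : cont_into Y F (fun y => if r y == i then sval l else 0).
  split; first exact: finite_metric_continuous.
  by move=> y; case: ifP.
have c0 : cont_into X F (fun=> 0) by split=> // x; exact: cvg_cst.
have /transport_planP/(_ _ _ c0 cl) := plan_pi.
rewrite [X in X + _](_ : _ = 0) ?add0r; last first.
  rewrite (@eq_Rintegral _ _ _ _ _ (fun=> 0)) ?Rintegral_cst// ?mul0r//.
rewrite [RHS](bigD1 i)//= eK eqxx big1 ?addr0; last first.
  by move=> j /negbTE ji; rewrite eK ji.
move=> planE; rewrite /b -planE -[LHS]Rintegral_indicM; apply: eq_Rintegral => z _.
rewrite add0r indicE; case: ifPn => [/eqP zi|zi].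
  by rewrite mem_set ?mul1r.
by rewrite memNset ?mul0r//= => zi'; rewrite zi' eqxx in zi.
Qed.

(** Measurability is for the Borel sets of the product topology, so measurability of the two
    components is not invoked directly. As [Y] is finite, the preimage of an open set is a finite
    union of fibres of [T] intersected with open sections. *)
Let graph_measurable (T : X -> Y) :
  measurable_fun setT (T : borel X -> borel Y) ->
  measurable_fun setT ((fun x => (x, T x)) : borel X -> borel (X * Y)%type).
Proof.
move=> mT; apply: (@measurability _ _ (borel X) (borel (X * Y)%type) setT
  (fun x => (x, T x)) (@open (X * Y)%type)) => //.
move=> _ [A oA <-]; rewrite setTI.
rewrite (_ : _ @^-1` A = \bigcup_(i in [set: I])
    ((T : borel X -> borel Y) @^-1` [set e i] `&` [set x | A (x, e i)])).
  apply: fin_bigcup_measurable; first exact: finite_finset.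
  move=> i _; apply: measurableI.
    rewrite -[X in measurable X]setTI; apply: mT => //.
    exact: finite_metric_measurable.
  apply: open_borel; apply: (@open_comp _ _ (fun x : X => (x, e i)) A) => // x _.
  by apply: cvg_pair; [exact: cvg_id|exact: cvg_cst].
apply/seteqP; split=> [x /= Ax|x [i _ [/= <-]]//].
by exists (r (T x)) => //=; rewrite rK.
Qed.

(** On the fibre of [T] over [e i] the functional [phi (T x)] is constant, so integrating it against
    the density gives its value at the measure of the fibre, which is the atom of [nu]. *)
Lemma transport_map_plan (T : X -> Y) : transport_maps mu nu T ->
  exists pi, transport_plans F mu nu pi /\
    forall c : X * Y -> R, measurable_fun setT (c : borel (X * Y)%type -> R) ->
      (forall z, 0 <= c z) ->
      (\int[pi]_z (c z)%:E = \int[lam]_x (c (x, T x))%:E)%E.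
Proof.
move=> [mT TE]; have mg := graph_measurable mT.
have [pi [piE pint]] := image_measure_exists lam measurableT mg.
exists pi; split; last first.
  move=> c mc c0.
  have mcE : measurable_fun setT (EFin \o c : borel (X * Y)%type -> \bar R).
    exact/measurable_EFinP.
  by rewrite (pint _ mcE).
apply/transport_planP => psi phi cpsi cphi.
have bP := plan_pairing_bounded_measurable cpsi cphi.
have bpsi := pairing_bounded_measurable cpsi.
rewrite (image_measure_Rintegral measurableT mg pint)//.
have bPT := bounded_measurable_comp mg bP.
(* [T] is only measurable, so continuity gives nothing here; the function is the difference of two
   known to be bounded measurable. *)
have bphi : bounded_measurable (fun x : borel X => phi (T x) (eta x)).
  have := bounded_measurableB bPT bpsi.
  by under eq_fun do rewrite /= addrC addrA addNr add0r.
rewrite -[LHS]/(\int[lam]_x (psi x (eta x) + phi (T x) (eta x))).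
rewrite RintegralD//; [|exact: bounded_measurable_integrable..].
congr (_ + _).
have TeE i : (r \o T) @^-1` [set i] = T @^-1` [set e i].
  by apply/seteqP; split=> x /= => [<-|->].
have mTe i : measurable (T @^-1` [set e i] : set (borel X)).
  rewrite -[X in measurable X]setTI; apply: mT => //.
  exact: finite_metric_measurable.
have mrT i : measurable ((r \o T : borel X -> I) @^-1` [set i]) by rewrite TeE.
rewrite (partition_Rintegral _ mrT)//; apply: eq_bigr => i _.
rewrite TeE -TE; last exact: finite_metric_measurable.
rewrite vmeasure_dual//; last by case: cphi => _; exact.
by apply: eq_Rintegral => x /set_mem /= ->.
Qed.

(** Since [F] separates points, the equality of vectors is checked on each [l] in [F], where it
    splits over the fibres into the constraints [b i l]. *)
Lemma selection_transport_map (s : X -> I) :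
  (forall i, measurable ((s : borel X -> I) @^-1` [set i])) ->
  (forall i l, \int[lam]_(x in s @^-1` [set i]) w l x = b i l) ->
  transport_maps mu nu (e \o s).
Proof.
move=> ms sb.
have mes (B : set Y) : measurable ((e \o s) @^-1` B : set (borel X)).
  rewrite (_ : _ @^-1` B = \bigcup_(i in [set i | B (e i)]) s @^-1` [set i]).
    by apply: fin_bigcup_measurable => //; exact: finite_finset.
  apply/seteqP; split=> [x /= Bx|x [i /= Bi ->]//].
  by exists (s x).
split=> [_ B _|B mB]; first by rewrite setTI.
have [->//|/eqP neq] := eqVneq (vmeasure_val mu ((e \o s) @^-1` B)) (vmeasure_val nu B).
have [l Fl] := separatingF neq; case.
rewrite vmeasure_dual// vmeasure_dual_finite.
have bl := dual_density_bounded_measurable Fl.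
have bz := finite_metric_bounded_measurable finiteY (fun y => l (density nu y)).
have bB := bounded_measurable_indic R mB.
have besB := bounded_measurable_indic R (mes B).
rewrite -[LHS]Rintegral_indicM -[RHS]Rintegral_indicM.
rewrite (partition_Rintegral _ ms); last exact: bounded_measurableM.
rewrite (partition_Rintegral _ mr); last exact: bounded_measurableM.
apply: eq_bigr => i _.
transitivity (\int[lam]_(x in s @^-1` [set i]) ((e i \in B)%:R * l (eta x))).
  apply: eq_Rintegral => x /set_mem /= <-; rewrite indicE; congr (_%:R * _).
transitivity (\int[Defs.variation nu]_(y in r @^-1` [set i])
    ((e i \in B)%:R * l (density nu y))); last first.
  by apply: eq_Rintegral => y /set_mem /= <-; rewrite rK indicE.
rewrite !RintegralZl//; [|exact: bounded_measurable_integrable..].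
congr (_ * _); transitivity (b i (exist _ l Fl)); first exact: (sb i (exist _ l Fl)).
by rewrite rE; exact: vmeasure_dual_finite.
Qed.

(** * Lower semicontinuous costs *)

Section lsc_cost.
Variable c : X * Y -> R.
Hypothesis lsc_c : lower_semicontinuous (fun z : X * Y => (c z)%:E).

Let open_c (a : R) : open [set z | a < c z].
Proof.
have /(_ a) := (lower_semicontinuousP _).1 lsc_c.
by under eq_set do rewrite lte_fin.
Qed.

Let mc : measurable_fun setT (c : borel (X * Y)%type -> R).
Proof. exact: open_rays_measurable. Qed.

Let mci i : measurable_fun setT ((fun x => c (x, e i)) : borel X -> R).
Proof.
apply: open_rays_measurable => a.
apply: (@open_comp _ _ (fun x : X => (x, e i)) [set z | a < c z]) => // x _.
by apply: cvg_pair; [exact: cvg_id|exact: cvg_cst].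
Qed.

Let c_lb : exists2 m : R, m <= 0 & forall z, m <= c z.
Proof.
have [| |z _ cz] := compact_lsc_min (J := fun z : X * Y => (c z)%:E) compactXY.
- by exists point.
- case=> [a| |].
  + rewrite (_ : [set _ | _] = ~` [set z | a < c z]); first exact: open_closedC.
    by apply/seteqP; split=> z /=; rewrite lee_fin leNgt => /negP.
  + rewrite (_ : [set _ | _] = setT); first exact: closedT.
    by apply/seteqP; split=> // z _ /=; rewrite leey.
  + rewrite (_ : [set _ | _] = set0); first exact: closed0.
    by apply/seteqP; split=> // z /=.
(* The minimum with 0 provides the nonpositive bound required by [integral_shift]. *)
exists (Num.min 0 (c z)) => [|z']; first by rewrite ge_min lexx.
by rewrite ge_min; apply/orP; right; rewrite -lee_fin; exact: cz.
Qed.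

(** Subtracting the lower bound [m] makes the cost nonnegative and moves both integrals by [m] times
    the total mass, which is the same for the plan and for [lam] by [plan_marginal]. *)
Lemma map_cost_plan (T : X -> Y) : transport_maps mu nu T ->
  exists2 pi, transport_plans F mu nu pi & plan_cost c pi = map_cost mu c T.
Proof.
move=> mapT; have [pi [plan_pi piE]] := transport_map_plan mapT.
exists pi => //; have [m m0 mc_le] := c_lb.
rewrite /plan_cost /map_cost (integral_shift pi mc m0 mc_le).
have mcT : measurable_fun setT ((fun x => c (x, T x)) : borel X -> R).
  by case: mapT => mT _; exact: (measurableT_comp mc (graph_measurable mT)).
rewrite (integral_shift lam mcT m0)//.
rewrite (piE (fun z => c z - m)); last 2 first.
- exact: measurable_funB.
- by move=> z; rewrite subr_ge0.
by rewrite -(plan_marginal plan_pi (A := setT))//.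
Qed.

Hypothesis divisible_mu : forall A : set (borel X), measurable A ->
  exists B : set (borel X), [/\ measurable B, B `<=` A &
    exists2 alpha : R, 0 < alpha < 1 &
      vmeasure_val mu B = alpha *: vmeasure_val mu A].

Lemma optimal_map_exists : transport_plans F mu nu !=set0 ->
  exists2 T, transport_maps mu nu T & forall pi, transport_plans F mu nu pi ->
    (map_cost mu c T <= plan_cost c pi)%E.
Proof.
move=> [pi0 plan_pi0]; have [m m0 mc_le] := c_lb.
have bw l : bounded_measurable (w l).
  by apply: dual_density_bounded_measurable; case: l.
(* Applying an element of [F] to the vector identity turns divisibility into the scalar form used by
   [bang_bang], with the same [B] and ratio for all functionals. *)
have div A : measurable A -> exists B, [/\ measurable B, B `<=` A &
    exists2 al : R, 0 < al < 1 & forall l,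
      \int[lam]_(x in B) w l x = al * \int[lam]_(x in A) w l x].
  move=> mA; have [B [mB BA [al al01 muB]]] := divisible_mu mA.
  exists B; split=> //; exists al => // -[l Fl].
  rewrite -[LHS](vmeasure_dual Fl mB) -[X in _ * X](vmeasure_dual Fl mA).
  by rewrite muB linearZ.
pose c' i (x : borel X) := c (x, e i) - m.
have mc' i : measurable_fun setT (c' i) by exact: measurable_funB.
have c'0 i x : 0 <= c' i x by rewrite subr_ge0.
have [pis0 [dec0 _]] := plan_decomposition plan_pi0.
have [s [ms sb smin]] := bang_bang bw div (r point) mc' c'0 dec0.
have mapT := selection_transport_map ms sb.
exists (e \o s) => // pi plan_pi.
have mcT : measurable_fun setT ((fun x => c (x, (e \o s) x)) : borel X -> R).
  by case: mapT => mT _; exact: (measurableT_comp mc (graph_measurable mT)).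
rewrite /plan_cost /map_cost (integral_shift pi mc m0 mc_le).
rewrite (integral_shift lam mcT m0)//.
rewrite -(plan_marginal plan_pi (A := setT))//; apply: leeD => //.
have [pis [dec pisE]] := plan_decomposition plan_pi.
rewrite -(pisE (fun z => c z - m)); last 3 first.
- exact: measurable_funB.
- by move=> i; exact: mc'.
- by move=> z; rewrite subr_ge0.
apply: le_trans (smin _ dec).
rewrite (partition_integral _ ms); last 2 first.
- by apply/measurable_EFinP; exact: measurable_funB.
- by move=> x; rewrite lee_fin subr_ge0.
apply: lee_sum => i _.
by rewrite (eq_integral (fun x => (c' i x)%:E))// => x /set_mem /= <-.
Qed.

End lsc_cost.

End transport_theory.

Theorem theorem3p62 (R : realType) (X Y : pmetricType R)
  (S : completeNormedModType R) (F : set (dual S))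
  (mu : vmeasure X S) (nu : vmeasure Y S)
  (compactX : compact [set: X])
  (finiteY : finite_set [set: Y])
  (subspaceF : linear_subspace F)
  (separatingF : separates_points F)
  (bounded_density : bounded_fun (density mu))
  (continuous_density : continuous (density mu : X -> weak_space F))
  (normalized_density : exists2 f, cont_into X F f &
     forall x, f x (density mu x) = 1)
  (divisible_mu : forall A : set (borel X), measurable A ->
     exists B : set (borel X), [/\ measurable B, B `<=` A &
       exists2 alpha : R, 0 < alpha < 1 &
         vmeasure_val mu B = alpha *: vmeasure_val mu A])
  (plans_neq0 : transport_plans F mu nu !=set0) :
  transport_maps mu nu !=set0 /\
  forall c : X * Y -> R,
    lower_semicontinuous (fun z : X * Y => (c z)%:E) ->
    exists m : \bar R,
      is_minimum [set map_cost mu c T | T in transport_maps mu nu] m /\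
      is_minimum [set plan_cost c pi | pi in transport_plans F mu nu] m.
Proof.
have [I [e [r [rK eK]]]] := finite_set_enum finiteY.
have opt c lsc_c := @optimal_map_exists _ _ _ _ F mu nu compactX finiteY
  subspaceF separatingF bounded_density continuous_density normalized_density
  I e r rK eK c lsc_c divisible_mu plans_neq0.
split=> [|c lsc_c].
  (* Existence of a transport map is the case of the zero cost. *)
  have [|T mapT _] := opt (fun=> 0); last by exists T.
  move=> z a a0; exists setT; first exact: filterT.
  by move=> y _.
(* The common minimum is the cost of [T], which bounds all plans from below; every map induces a
   plan of the same cost, so it also bounds all maps, and [T] itself yields an optimal plan. *)
have [T mapT Tmin] := opt c lsc_c; exists (map_cost mu c T).
have mapP T' (mapT' : transport_maps mu nu T') := map_cost_plan compactX finiteY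
  subspaceF bounded_density continuous_density normalized_density rK eK lsc_c mapT'.
split; split.
- by exists T.
- move=> _ [T' mapT' <-]; have [pi plan_pi <-] := mapP _ mapT'; exact: Tmin.
- by have [pi plan_pi <-] := mapP _ mapT; exists pi.
- by move=> _ [pi plan_pi <-]; exact: Tmin.
Qed.
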